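(* Let $\mathcal C$ be a Lawvere theory with a zero object. If the ground ring $\Bbbk$ is a field, then the monad map $\mathcal E_{\mathcal C}:\mu\mathfrak O_{\mathcal C}\to\Phi_{\mathcal C}$ is an isomorphism. In particular, the PROP $\tilde\Phi_{\mathcal C}$ is operadic.
   Context: $\mathbb N=\{0,1,2,\dots\}$; $\mathfrak S_n$ is the symmetric group. A monad $\mathtt T$ on a set $\mathcal X$ (in the bicategory of matrices of $\Bbbk$-modules) is a family of $\Bbbk$-modules $\mathtt T(Y,X)$ with associative bilinear composition $\mathtt T(Z,Y)\otimes\mathtt T(Y,X)\to\mathtt T(Z,X)$ and units; it is the same as a $\Bbbk$-linear category $\tilde{\mathtt T}$ with object set $\mathcal X$ and $\tilde{\mathtt T}(X,Y)=\mathtt T(Y,X)$. A Lawvere theory is a category $\mathcal C$ with finite products and object set $\mathbb N$, the product on objects being addition. $\mathtt L_{\mathcal C}(m,n)=\Bbbk[\mathcal C(n,m)]$. If $\mathcal C$ has a zero object, let $\Delta\in\mathcal C(1,2)$ be the diagonal, $\eta\in\mathcal C(0,1)$ the zero morphism, $\bar\Delta^{n,k}=\mathrm{id}_{k-1}\times\Delta\times\mathrm{id}_{n-k}-\mathrm{id}_k\times\eta\times\mathrm{id}_{n-k}-\mathrm{id}_{k-1}\times\eta\times\mathrm{id}_{n-k+1}\in\mathtt L_{\mathcal C}(n+1,n)$ ($n\ge1$, $1\le k\le n$). $\mathtt I^{\mathsf{pr}}_{\mathcal C}$ is the left ideal they generate, i.e. $\mathtt I^{\mathsf{pr}}_{\mathcal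 C}(m,n)$ is spanned by $f\circ\bar\Delta^{n,k}$, $f\in\mathtt L_{\mathcal C}(m,n+1)$. $\Phi_{\mathcal C}$ is the eigenmonad: $\Phi_{\mathcal C}(m,n)=\{f\in\mathtt L_{\mathcal C}(m,n):\mathtt I^{\mathsf{pr}}_{\mathcal C}(l,m)\circ f\subset\mathtt I^{\mathsf{pr}}_{\mathcal C}(l,n)\ \forall l\}/\mathtt I^{\mathsf{pr}}_{\mathcal C}(m,n)$. $\tilde\Phi_{\mathcal C}$ is a $\Bbbk$-linear PROP ($\Bbbk$-linear permutative category with object set $\mathbb N$ and addition as monoidal structure on objects), with $[u_1]\boxtimes[u_2]=[u_1\times u_2]$ and symmetry induced by that of $\mathcal C$. For $\sigma\in\mathfrak S_n$, $E_\sigma=(p_{n,\sigma^{-1}(1)},\dots,p_{n,\sigma^{-1}(n)})\in\mathcal C(n,n)$ ($p_{n,k}$ projections). The underlying operad of $\tilde\Phi_{\mathcal C}$ is $\mathfrak O_{\mathcal C}(n)=\tilde\Phi_{\mathcal C}(n,1)=\Phi_{\mathcal C}(1,n)$, with $[f]\lhd\sigma=[f\circ E_\sigma]$, unit $[\mathrm{id}_1]$ and composition $[f]\circ([g_1],\dots,[g_m])=[f\circ(g_1\times\dots\times g_m)]$. For an operad $\mathfrak O$, $\mu\mathfrak O$ is the monad on $\mathbb N$ with $\mu\mathfrak O(m,n)=\bigoplus_{n_1+\dots+n_m=n}\left(\bigotimes_{i}\mathfrak O(n_i)\right)\otimes_{\mathfrak S_{n_1}\times\dots\times\mathfrak S_{n_m}}\Bbbk[\mathfrak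 S_n]\cong\bigoplus_{f:\{1,\dots,n\}\to\{1,\dots,m\}}\bigotimes_i\mathfrak O(f^{-1}(i))$ and composition induced by operad composition; the corresponding category is the PROP $\mathsf{Cat}\,\mathfrak O$ associated with $\mathfrak O$. $\mathcal E_{\mathcal C}$ is $\bigotimes_k[f_k]\otimes\sigma\mapsto[(f_1\times\dots\times f_m)\circ E_\sigma]$. A PROP $\mathcal P$ with underlying operad $\mathfrak O(n)=\mathcal P(n,1)$ is operadic if the natural PROP morphism $\mathsf{Cat}\,\mathfrak O\to\mathcal P$ is an isomorphism. *)

(* Defs.v *)
From HB Require Import structures.
From mathcomp Require Import all_boot all_order all_fingroup all_algebra.
From mathcomp Require Import finmap boolp.
From mathcomp Require Import monalg generic_quotient.

Set Implicit Arguments.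
Unset Strict Implicit.
Unset Printing Implicit Defensive.

Import GRing.Theory.
Local Open Scope quotient_scope.
Local Open Scope ring_scope.

Lemma lin0 (R : nzRingType) (V V' : lmodType R) (f : V -> V') : linear f -> f 0 = 0.
Proof. by move=> lf; have := lf (-1) 0 0; rewrite scaler0 addr0 scaleN1r addNr. Qed.

Record submod (R : nzRingType) (V : lmodType R) := Submod {
  sm_mem :> {pred V};
  sm_closed : submod_closed sm_mem }.
HB.instance Definition _ (R : nzRingType) (V : lmodType R) (W : submod V) :=
  GRing.isSubmodClosed.Build R V (sm_mem W)
    (GRing.submod_closed_semi (sm_closed W)).
Definition sm_zmod (R : nzRingType) (V : lmodType R) (W : submod V) :
    zmodClosed V :=
  HB.pack (sm_mem W) (GRing.isZmodClosed.Build V (sm_mem W)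
    (GRing.submod_closedB (sm_closed W))).

Section Span.
Variables (R : nzRingType) (V : lmodType R) (S : V -> Prop).

Inductive Span : V -> Prop :=
| Span0 : Span 0
| SpanS a u v : S u -> Span v -> Span (a *: u + v).

Definition span : {pred V} := fun v => `[< Span v >].

Lemma spanP v : reflect (Span v) (v \in span).
Proof. exact: asboolP. Qed.

Lemma span_submod : submod_closed span.
Proof.
split=> [|a u v /spanP Su /spanP Sv]; first exact/spanP/Span0.
apply/spanP; elim: Su => [|b w x Sw _ IH]; first by rewrite scaler0 add0r.
by rewrite scalerDr scalerA -addrA; apply: SpanS.
Qed.
Definition span_sm := Submod span_submod.

Lemma mem_span v : S v -> v \in span.
Proof. by move=> Sv; apply/spanP; rewrite -[v]addr0 -[v]scale1r; apply/SpanS/Span0. Qed.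
End Span.

Section QuotientModule.
Variables (R : nzRingType) (V : lmodType R) (W : submod V).

Definition qmod := Quotient.quot (sm_zmod W).
HB.instance Definition _ := GRing.Zmodule.on qmod.

Definition qcls (v : V) : qmod := \pi_(Quotient.quot (sm_zmod W)) v.
Definition qscale (a : R) (x : qmod) : qmod := qcls (a *: repr (x : Quotient.quot (sm_zmod W))).

Lemma qcls_eq u v : (qcls u = qcls v) <-> (u - v \in W).
Proof. by rewrite (Quotient.idealrBE (sm_zmod W)); split=> [e|/eqP]; first exact/eqP. Qed.

Lemma qclsP x : exists v, x = qcls v.
Proof. by exists (repr (x : Quotient.quot (sm_zmod W))); rewrite /qcls reprK. Qed.

Lemma qclsD : {morph qcls : u v / u + v}.
Proof. by move=> u v; rewrite /qcls !piE. Qed.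

Lemma qclsZ a u : qcls (a *: u) = qscale a (qcls u).
Proof.
by apply/qcls_eq; rewrite -scalerBr rpredZ //; apply/qcls_eq; rewrite {2}/qcls reprK.
Qed.

Lemma qscaleA a b x : qscale a (qscale b x) = qscale (a * b) x.
Proof. by have [v ->] := qclsP x; rewrite -!qclsZ scalerA. Qed.
Lemma qscale1 : left_id 1 qscale.
Proof. by move=> x; have [v ->] := qclsP x; rewrite -!qclsZ scale1r. Qed.
Lemma qscaleDr : right_distributive qscale +%R.
Proof.
move=> a x y; have [u ->] := qclsP x; have [v ->] := qclsP y.
by rewrite -qclsD -!qclsZ -qclsD scalerDr.
Qed.
Lemma qscaleDl x : {morph qscale^~ x : a b / a + b}.
Proof. by move=> a b; have [u ->] := qclsP x; rewrite -!qclsZ -qclsD scalerDl. Qed.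
HB.instance Definition _ := GRing.Zmodule_isLmodule.Build R qmod
  qscaleA qscale1 qscaleDr qscaleDl.

Lemma qcls_linear : linear qcls.
Proof. by move=> a u v; rewrite qclsD qclsZ. Qed.
HB.instance Definition _ := GRing.isLinear.Build R V qmod *:%R qcls qcls_linear.
End QuotientModule.

Section Submodule.
Variables (R : nzRingType) (V : lmodType R) (A W : submod V).

Record smod := Smod { smod_val :> V; smodP : smod_val \in A }.
HB.instance Definition _ := [isSub for smod_val].
HB.instance Definition _ := [Choice of smod by <:].
HB.instance Definition _ := [SubChoice_isSubLmodule of smod by <:].

Definition srestr : {pred smod} := fun x => val x \in W.
Lemma srestr_submod : submod_closed srestr.
Proof.
split=> [|a u v].
  by change (val (0 : smod) \in W); rewrite raddf0 (sm_closed W).1.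
change (val u \in W -> val v \in W -> val (a *: u + v) \in W) => Wu Wv.
by rewrite linearP; apply: (sm_closed W).2.
Qed.
(* A / (A :&: W), for submodules A and W of the same module. *)
Definition subquot : lmodType R := qmod (Submod srestr_submod).
End Submodule.

Section FreeModule.
Variables (R : comNzRingType) (X : choiceType) (V : lmodType R) (h : X -> V).
Definition flin (u : {malg R[X]}) : V := \sum_(x <- msupp u) u@_x *: h x.

Lemma flinEw (d : {fset X}) u : (msupp u `<=` d)%fset ->
  flin u = \sum_(x <- d) u@_x *: h x.
Proof.
move=> le; rewrite /flin (big_fset_incl _ le) // => x xd xu.
by rewrite mcoeff_outdom // scale0r.
Qed.

Lemma flin_is_linear : linear flin.
Proof.
move=> a u v.
pose d := (msupp u `|` msupp v `|` msupp (a *: u + v))%fset.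
have du : (msupp u `<=` d)%fset by rewrite /d -fsetUA fsubsetUl.
have dv : (msupp v `<=` d)%fset.
  by apply: fsubset_trans (fsubsetUl _ _); apply: fsubsetUr.
have dw : (msupp (a *: u + v) `<=` d)%fset by apply: fsubsetUr.
rewrite (flinEw du) (flinEw dv) (flinEw dw) scaler_sumr -big_split /=.
by apply: eq_bigr => x _; rewrite mcoeffD mcoeffZ scalerDl scalerA.
Qed.
HB.instance Definition _ := GRing.isLinear.Build R {malg R[X]} V *:%R flin flin_is_linear.

Lemma flinU x : flin << x >> = h x.
Proof.
by rewrite (flinEw msuppU_le) big_seq_fset1 mcoeffUU scale1r.
Qed.
End FreeModule.

Section FreeExt.
Variables (R : comNzRingType) (X : choiceType) (V : lmodType R).
Lemma malg_ind (P : {malg R[X]} -> Prop) :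
  P 0 -> (forall a x u, P u -> P (a *: << x >> + u)) -> forall u, P u.
Proof.
move=> P0 PS u; rewrite [u]monalgE; elim: (enum_fset _) => [|x s IH].
  by rewrite big_nil.
rewrite big_cons; have -> : << u@_x *g x >> = u@_x *: << x >> :> {malg R[X]}.
  by apply/malgP => y; rewrite mcoeffZ !mcoeffU mulr_natr.
exact: PS.
Qed.

Lemma lin_ext (f g : {malg R[X]} -> V) : linear f -> linear g ->
  (forall x, f << x >> = g << x >>) -> f =1 g.
Proof.
move=> lf lg fg.
apply: malg_ind => [|a x u IH]; first by rewrite !lin0.
by rewrite lf lg fg IH.
Qed.
End FreeExt.

Section SubquotientMaps.
Variables (R : nzRingType) (V : lmodType R) (A W : submod V).

Definition scls (v : V) (Av : v \in A) : subquot A W := qcls _ (Smod Av).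
Definition srep (x : subquot A W) : smod A := repr (x : Quotient.quot _).

Lemma scls_eq u v (Au : u \in A) (Av : v \in A) :
  scls Au = scls Av <-> u - v \in W.
Proof.
by rewrite /scls qcls_eq; change (val (Smod Au - Smod Av) \in W <-> u - v \in W);
  rewrite raddfB.
Qed.

Lemma srepK x : scls (smodP (srep x)) = x.
Proof. by rewrite /scls /qcls -[RHS](reprK (x : Quotient.quot _)); congr pi; apply: val_inj. Qed.

Lemma sclsP x : exists v (Av : v \in A), x = scls Av.
Proof. by exists (srep x), (smodP (srep x)); rewrite srepK. Qed.

Lemma scls_lin a u v (Au : u \in A) (Av : v \in A) (Auv : a *: u + v \in A) :
  scls Auv = a *: scls Au + scls Av.
Proof. by rewrite /scls -linearP; congr qcls; apply: val_inj; rewrite linearP. Qed.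
End SubquotientMaps.

Section SubquotientMap2.
Variables (R : nzRingType) (V1 V2 V3 : lmodType R).
Variables (A1 W1 : submod V1) (A2 W2 : submod V2) (A3 W3 : submod V3).
Variable b : V1 -> V2 -> V3.
Hypothesis bA : forall u v, u \in A1 -> v \in A2 -> b u v \in A3.

(* The bilinear map induced by b on classes; it does not depend on the chosen
   representatives by sqmap2E. *)
Definition sqmap2 (x : subquot A1 W1) (y : subquot A2 W2) : subquot A3 W3 :=
  scls W3 (bA (smodP (srep x)) (smodP (srep y))).

Hypothesis b_linl : forall v, linear (b^~ v).
Hypothesis b_linr : forall u, linear (b u).
Hypothesis bWl : forall u v, u \in W1 -> v \in A2 -> b u v \in W3.
Hypothesis bWr : forall u v, u \in A1 -> v \in W2 -> b u v \in W3.

Lemma sqmap2E u v (Au : u \in A1) (Av : v \in A2) :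
  sqmap2 (scls W1 Au) (scls W2 Av) = scls W3 (bA Au Av).
Proof.
have bBl u1 u2 w : b (u1 - u2) w = b u1 w - b u2 w.
  by rewrite addrC -scaleN1r b_linl scaleN1r addrC.
have bBr w u1 u2 : b w (u1 - u2) = b w u1 - b w u2.
  by rewrite addrC -scaleN1r b_linr scaleN1r addrC.
apply/scls_eq; set u' := srep _; set v' := srep _.
have Wu : val u' - u \in W1 by apply/(scls_eq _ (smodP u') Au); rewrite srepK.
have Wv : val v' - v \in W2 by apply/(scls_eq _ (smodP v') Av); rewrite srepK.
rewrite (_ : _ - _ = 1 *: b (val u' - u) (val v') + b u (val v' - v)).
  by apply: (sm_closed W3).2; [apply: bWl (smodP _) | apply: bWr].
by rewrite scale1r bBl bBr addrA addrNK.
Qed.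

Lemma sqmap2_linl y : linear (sqmap2^~ y).
Proof.
move=> a x x'; have [v [Av ->]] := sclsP y.
have [u [Au ->]] := sclsP x; have [u' [Au' ->]] := sclsP x'.
have Aw : a *: u + u' \in A1 by apply: (sm_closed A1).2.
rewrite -(scls_lin _ Au Au' Aw) !sqmap2E.
have Ab : a *: b u v + b u' v \in A3 by apply: (sm_closed A3).2; apply: bA.
rewrite -(scls_lin _ (bA Au Av) (bA Au' Av) Ab).
by apply/scls_eq; rewrite b_linl subrr (sm_closed W3).1.
Qed.

Lemma sqmap2_linr x : linear (sqmap2 x).
Proof.
move=> a y y'; have [u [Au ->]] := sclsP x.
have [v [Av ->]] := sclsP y; have [v' [Av' ->]] := sclsP y'.
have Aw : a *: v + v' \in A2 by apply: (sm_closed A2).2.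
rewrite -(scls_lin _ Av Av' Aw) !sqmap2E.
have Ab : a *: b u v + b u v' \in A3 by apply: (sm_closed A3).2; apply: bA.
rewrite -(scls_lin _ (bA Au Av) (bA Au Av') Ab).
by apply/scls_eq; rewrite b_linr subrr (sm_closed W3).1.
Qed.
End SubquotientMap2.
Arguments sqmap2 {R V1 V2 V3 A1 W1 A2 W2 A3 W3 b} bA x y.

Section BilinearExtension.
Variables (R : comNzRingType) (X Y : choiceType) (V : lmodType R).
Variable h : X -> Y -> V.
Definition flin2 (u : {malg R[X]}) (v : {malg R[Y]}) : V :=
  flin (fun x => flin (h x) v) u.

Lemma flin2_linl v : linear (flin2^~ v).
Proof. by move=> a u u'; rewrite /flin2 linearP. Qed.
Lemma flin2_linr u : linear (flin2 u).
Proof.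
move=> a v v'; rewrite /flin2 /flin scaler_sumr -big_split /=.
apply: eq_bigr => x _; rewrite -/(flin (h x) _) linearP scalerDr !scalerA.
by rewrite [a * _]mulrC.
Qed.
Lemma flin2U x y : flin2 << x >> << y >> = h x y.
Proof. by rewrite /flin2 !flinU. Qed.
End BilinearExtension.

(* A Lawvere theory: objects are the natural numbers, hom m n = C(m, n), and n
   is the n-th power of 1 with projections proj i = p_{n,i+1}. Thus m + n is the
   product of m and n, with projections onto the first m and the last n
   coordinates. The convention proj1 makes the projections 1 -> 1 used for
   products of morphisms agree with the identity. *)
Record lawvere := Lawvere {
  hom : nat -> nat -> Type;
  idm : forall n, hom n n;
  cmp : forall l m n, hom m n -> hom l m -> hom l n;
  cmpA : forall k l m n (h : hom m n) (g : hom l m) (f : hom k l),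
    cmp h (cmp g f) = cmp (cmp h g) f;
  cmp1f : forall m n (f : hom m n), cmp (idm n) f = f;
  cmpf1 : forall m n (f : hom m n), cmp f (idm m) = f;
  proj : forall n, 'I_n -> hom n 1;
  tup : forall m n, ('I_n -> hom m 1) -> hom m n;
  proj_tup : forall m n (f : 'I_n -> hom m 1) i, cmp (proj i) (tup f) = f i;
  proj_ext : forall m n (f g : hom m n),
    (forall i, cmp (proj i) f = cmp (proj i) g) -> f = g;
  proj1 : forall i : 'I_1, proj i = idm 1 }.

HB.instance Definition _ (C : lawvere) m n := gen_eqMixin (hom C m n).
HB.instance Definition _ (C : lawvere) m n := gen_choiceMixin (hom C m n).

Arguments idm {C} n : rename.
Arguments cmp {C l m n} _ _ : rename.
Arguments proj {C n} i : rename.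
Arguments tup {C m n} _ : rename.
Notation "f \oc g" := (cmp f g) (at level 40, left associativity).

Record zero_object (C : lawvere) := ZeroObject {
  zob : nat;
  zfrom : forall n, hom C zob n;
  zto : forall m, hom C m zob;
  zfrom_uniq : forall n (f : hom C zob n), f = zfrom n;
  zto_uniq : forall m (f : hom C m zob), f = zto m }.

Definition zmor (C : lawvere) (Z : zero_object C) m n : hom C m n :=
  zfrom Z n \oc zto Z m.

Section LawvereTheory.
Variable C : lawvere.

Definition prl m n : hom C (m + n) m := tup (fun i => proj (lshift n i)).
Definition prr m n : hom C (m + n) n := tup (fun i => proj (rshift m i)).
Definition pairm l m n (f : hom C l m) (g : hom C l n) : hom C l (m + n) :=
  tup (fun i => match split i with
                | inl a => proj a \oc f
                | inr b => proj b \oc g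
                end).
Definition prodm m n m' n' (f : hom C m n) (g : hom C m' n') :
    hom C (m + m') (n + n') :=
  pairm (f \oc prl m m') (g \oc prr m m').
Definition swapm m n : hom C (m + n) (n + m) := pairm (prr m n) (prl m n).
Definition diag : hom C 1 2 := tup (fun=> idm 1).
(* E_s = (p_{n, s^-1(1)}, ..., p_{n, s^-1(n)}); for composition of permutations
   as functions, E_(s o t) = E_s o E_t, while (s * t)%g is t o s in MathComp. *)
Definition Emor n (s : 'S_n) : hom C n n := tup (fun i => proj (s^-1%g i)).

Lemma tupE m n (f : 'I_n -> hom C m 1) g : (forall i, proj i \oc g = f i) -> tup f = g.
Proof. by move=> fg; apply: proj_ext => i; rewrite proj_tup. Qed.

Lemma tup_comp l m n (f : 'I_n -> hom C m 1) (g : hom C l m) :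
  tup f \oc g = tup (fun i => f i \oc g).
Proof. by apply: proj_ext => i; rewrite cmpA !proj_tup. Qed.

Lemma prl_pair l m n (f : hom C l m) (g : hom C l n) : prl m n \oc pairm f g = f.
Proof.
rewrite tup_comp; apply: tupE => i; rewrite proj_tup.
by rewrite -[lshift n i]/(unsplit (inl i)) unsplitK.
Qed.
Lemma prr_pair l m n (f : hom C l m) (g : hom C l n) : prr m n \oc pairm f g = g.
Proof.
rewrite tup_comp; apply: tupE => i; rewrite proj_tup.
by rewrite -[rshift m i]/(unsplit (inr i)) unsplitK.
Qed.
Lemma pair_ext l m n (f g : hom C l (m + n)) :
  prl m n \oc f = prl m n \oc g -> prr m n \oc f = prr m n \oc g -> f = g.
Proof.
move=> el er; apply: proj_ext => i; rewrite -[i]splitK.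
case: (split i) => j /=.
  have -> : proj (lshift n j) = proj j \oc prl m n :> hom C _ _ by rewrite proj_tup.
  by rewrite -!cmpA el.
have -> : proj (rshift m j) = proj j \oc prr m n :> hom C _ _ by rewrite proj_tup.
by rewrite -!cmpA er.
Qed.
Lemma pair_comp k l m n (f : hom C l m) (g : hom C l n) (h : hom C k l) :
  pairm f g \oc h = pairm (f \oc h) (g \oc h).
Proof. by apply: pair_ext; rewrite cmpA !(prl_pair, prr_pair). Qed.
Lemma prl_prodm m n m' n' (f : hom C m n) (g : hom C m' n') :
  prl n n' \oc prodm f g = f \oc prl m m'.
Proof. exact: prl_pair. Qed.
Lemma prr_prodm m n m' n' (f : hom C m n) (g : hom C m' n') :
  prr n n' \oc prodm f g = g \oc prr m m'.
Proof. exact: prr_pair. Qed.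
Lemma prodm_pair l m n m' n' (f : hom C m n) (g : hom C m' n')
    (u : hom C l m) (v : hom C l m') :
  prodm f g \oc pairm u v = pairm (f \oc u) (g \oc v).
Proof. by rewrite pair_comp -!cmpA prl_pair prr_pair. Qed.
Lemma prodm_comp l m n l' m' n' (f : hom C m n) (g : hom C l m)
    (f' : hom C m' n') (g' : hom C l' m') :
  prodm f f' \oc prodm g g' = prodm (f \oc g) (f' \oc g').
Proof. by rewrite prodm_pair !cmpA. Qed.
Lemma prodm1 m n : prodm (idm m) (idm n) = idm (m + n) :> hom C _ _.
Proof. by apply: pair_ext; rewrite (prl_prodm, prr_prodm) cmp1f cmpf1. Qed.
Lemma swapK m n : swapm n m \oc swapm m n = idm (m + n).
Proof.
by rewrite pair_comp prr_pair prl_pair; apply: pair_ext; rewrite (prl_pair, prr_pair) cmpf1.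
Qed.
Lemma swap_nat m n m' n' (f : hom C m n) (g : hom C m' n') :
  swapm n n' \oc prodm f g = prodm g f \oc swapm m m'.
Proof. by rewrite prodm_pair pair_comp prl_prodm prr_prodm. Qed.

Definition castm m m' n n' (em : m = m') (en : n = n') (f : hom C m n) : hom C m' n' :=
  ecast n _ en (ecast m _ em f).
Arguments castm : simpl never.

Lemma proj_cast m n n' (en : n = n') (f : hom C m n) i :
  proj i \oc castm (erefl m) en f = proj (cast_ord (esym en) i) \oc f.
Proof. by case: n' / en i => i; rewrite cast_ord_id. Qed.
Lemma cast_proj n n' (en : n = n') (i : 'I_n) :
  castm en (erefl 1) (proj i) = proj (cast_ord en i).
Proof. by case: n' / en; rewrite cast_ord_id. Qed.
Lemma castmE m m' n n' (em : m = m') (en : n = n') (f : hom C m n) i :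
  proj i \oc castm em en f = castm em (erefl 1) (proj (cast_ord (esym en) i) \oc f).
Proof. by case: m' / em; rewrite proj_cast. Qed.
Lemma cast_compr l l' m n (el : l = l') (f : hom C m n) (g : hom C l m) :
  castm el (erefl n) (f \oc g) = f \oc castm el (erefl m) g.
Proof. by case: l' / el. Qed.

Lemma proj_prodm_l m n m' n' (f : hom C m n) (g : hom C m' n') i :
  proj (lshift n' i) \oc prodm f g = proj i \oc f \oc prl m m'.
Proof.
have -> : proj (lshift n' i) = proj i \oc prl n n' :> hom C _ _ by rewrite proj_tup.
by rewrite -cmpA prl_prodm cmpA.
Qed.
Lemma proj_prodm_r m n m' n' (f : hom C m n) (g : hom C m' n') i :
  proj (rshift n i) \oc prodm f g = proj i \oc g \oc prr m m'.
Proof.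
have -> : proj (rshift n i) = proj i \oc prr n n' :> hom C _ _ by rewrite proj_tup.
by rewrite -cmpA prr_prodm cmpA.
Qed.

Lemma prl_cast m n p (e : m + (n + p) = m + n + p) :
  castm e (erefl m) (prl m (n + p)) = prl m n \oc prl (m + n) p.
Proof.
apply: proj_ext => i; rewrite castmE cast_ord_id !proj_tup cast_proj cmpA !proj_tup.
by congr proj; apply: val_inj.
Qed.
Lemma prlr_cast m n p (e : m + (n + p) = m + n + p) :
  castm e (erefl n) (prl n p \oc prr m (n + p)) = prr m n \oc prl (m + n) p.
Proof.
apply: proj_ext => i.
rewrite castmE cast_ord_id cmpA !proj_tup cast_proj cmpA !proj_tup.
by congr proj; apply: val_inj.
Qed.
Lemma prrr_cast m n p (e : m + (n + p) = m + n + p) :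
  castm e (erefl p) (prr n p \oc prr m (n + p)) = prr (m + n) p.
Proof.
apply: proj_ext => i.
rewrite castmE cast_ord_id cmpA !proj_tup cast_proj.
by congr proj; apply: val_inj; rewrite /= addnA.
Qed.

Lemma prodmA m n m' n' m'' n'' (f : hom C m n) (g : hom C m' n') (h : hom C m'' n'') :
  castm (addnA m m' m'') (addnA n n' n'') (prodm f (prodm g h))
  = prodm (prodm f g) h.
Proof.
apply: proj_ext => i; rewrite castmE -[i]splitK.
case: (split i) => [j|j] /=; last first.
  have -> : cast_ord (esym (addnA n n' n'')) (rshift (n + n') j) =
            rshift n (rshift n' j) by apply: val_inj; rewrite /= addnA.
  rewrite !proj_prodm_r -[_ \oc _ \oc prr m _]cmpA.
  by rewrite cast_compr prrr_cast.
rewrite -[j]splitK; case: (split j) => [k|k] /=.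
  have -> : cast_ord (esym (addnA n n' n'')) (lshift n'' (lshift n' k)) =
            lshift (n' + n'') k by apply: val_inj.
  by rewrite !proj_prodm_l cast_compr prl_cast !cmpA.
have -> : cast_ord (esym (addnA n n' n'')) (lshift n'' (rshift n k)) =
            rshift n (lshift n'' k) by apply: val_inj.
rewrite !(proj_prodm_l, proj_prodm_r) -[_ \oc _ \oc prr m _]cmpA.
by rewrite cast_compr prlr_cast !cmpA.
Qed.


Lemma prod0m m n (f : hom C m n) : prodm (idm 0) f = f.
Proof.
apply: proj_ext => i.
have -> : i = rshift 0 i by apply: val_inj.
rewrite proj_prodm_r -cmpA.
have -> : prr 0 m = idm m.
  by apply: tupE => j; rewrite cmpf1; congr proj; apply: val_inj.
by rewrite cmpf1; congr (proj _ \oc _); apply: val_inj.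
Qed.

Lemma prodm0 m n (f : hom C m n) :
  castm (addn0 m) (addn0 n) (prodm f (idm 0)) = f.
Proof.
apply: proj_ext => i; rewrite castmE.
have -> : cast_ord (esym (addn0 n)) i = lshift 0 i by apply: val_inj.
rewrite proj_prodm_l cast_compr.
have -> : castm (addn0 m) (erefl m) (prl m 0) = idm m.
  apply: proj_ext => j; rewrite castmE cast_ord_id proj_tup cast_proj cmpf1.
  by congr proj; apply: val_inj.
by rewrite cmpf1.
Qed.
End LawvereTheory.

Arguments castm : simpl never.

Section LawvereSymmetry.
Variable C : lawvere.

Lemma proj_prl m n (j : 'I_m) : proj j \oc prl C m n = proj (lshift n j).
Proof. exact: proj_tup. Qed.
Lemma proj_prr m n (j : 'I_n) : proj j \oc prr C m n = proj (rshift m j).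
Proof. exact: proj_tup. Qed.

Lemma swap_hex m n p :
  castm (addnA m n p) (esym (addnA n p m)) (swapm C m (n + p))
  = prodm (idm n) (swapm C m p) \oc
    castm (erefl _) (esym (addnA n m p)) (prodm (swapm C m n) (idm p)).
Proof.
have pl j : proj (lshift m (lshift p j)) \oc swapm C m (n + p) =
            proj (rshift m (lshift p j)).
  by rewrite proj_tup (_ : split _ = inl (lshift p j)) ?proj_tup //;
     rewrite -[lshift m _]/(unsplit (inl _)) unsplitK.
have pm j : proj (lshift m (rshift n j)) \oc swapm C m (n + p) =
            proj (rshift m (rshift n j)).
  by rewrite proj_tup (_ : split _ = inl (rshift n j)) ?proj_tup //;
     rewrite -[lshift m _]/(unsplit (inl _)) unsplitK.
have pr j : proj (rshift (n + p) j) \oc swapm C m (n + p) =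
            proj (lshift (n + p) j).
  by rewrite proj_tup (_ : split _ = inr j) ?proj_tup //;
     rewrite -[rshift _ _]/(unsplit (inr _)) unsplitK.
have ql a b j : proj (lshift a j) \oc swapm C a b = proj (rshift a j).
  by rewrite proj_tup (_ : split _ = inl j) ?proj_tup //;
     rewrite -[lshift _ _]/(unsplit (inl _)) unsplitK.
have qr a b j : proj (rshift b j) \oc swapm C a b = proj (lshift b j).
  by rewrite proj_tup (_ : split _ = inr j) ?proj_tup //;
     rewrite -[rshift _ _]/(unsplit (inr _)) unsplitK.
apply: proj_ext => i; rewrite -[i]splitK; case: (split i) => [j|j] /=.
  rewrite castmE cmpA proj_prodm_l cmpf1 proj_prl castmE.
  have -> : cast_ord (esym (esym (addnA n m p))) (lshift (m + p) j) = lshift p (lshift m j).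
    by apply: val_inj.
  rewrite proj_prodm_l ql.
  have -> : cast_ord (esym (esym (addnA n p m))) (lshift (p + m) j) = lshift m (lshift p j).
    by apply: val_inj.
  rewrite pl cast_proj.
  rewrite proj_prl /castm /=.
  by congr proj; apply: val_inj.
rewrite castmE cmpA proj_prodm_r -cmpA.
rewrite -[j]splitK; case: (split j) => [k|k] /=.
  have -> : cast_ord (esym (esym (addnA n p m))) (rshift n (lshift m k)) = lshift m (rshift n k).
    by apply: val_inj.
  rewrite pm cast_proj cmpA ql proj_prr castmE.
  have -> : cast_ord (esym (esym (addnA n m p))) (rshift n (rshift m k)) = rshift (n + m) k.
    by apply: val_inj; rewrite /= addnA.
  rewrite proj_prodm_r cmpf1 proj_prr /castm /=.
  by congr proj; apply: val_inj; rewrite /= addnA.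
have -> : cast_ord (esym (esym (addnA n p m))) (rshift n (rshift p k)) = rshift (n + p) k.
  by apply: val_inj; rewrite /= addnA.
rewrite pr cast_proj cmpA qr proj_prr castmE.
have -> : cast_ord (esym (esym (addnA n m p))) (rshift n (lshift p k)) = lshift p (rshift n k).
  by apply: val_inj.
rewrite proj_prodm_l qr proj_prl /castm /=.
by congr proj; apply: val_inj.
Qed.

Lemma Emor1 n : Emor C (1%g : 'S_n) = idm n.
Proof. by apply: tupE => i; rewrite cmpf1 invg1 perm1. Qed.

Lemma EmorM n (s t : 'S_n) : Emor C s \oc Emor C t = Emor C (t * s)%g.
Proof. by apply: proj_ext => i; rewrite cmpA !proj_tup invMg permM. Qed.

Lemma proj_swap_cycle n (a : 'I_n.+1) (e1 : (1 + a + (n - a) = n.+1)%N)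
    (e2 : (a + 1 + (n - a) = n.+1)%N) (i : 'I_n.+1) :
  proj i \oc castm e1 e2 (prodm (swapm C 1 a) (idm (n - a)%N))
  = proj (if unlift a i is Some j then lift ord0 j else ord0).
Proof.
rewrite castmE.
case: unliftP => [j ->|->].
  have [lt_ja|le_aj] := ltnP j a.
    have -> : cast_ord (esym e2) (lift a j) = lshift (n - a)%N (lshift 1 (Ordinal lt_ja)).
      by apply: val_inj; rewrite /= /bump leqNgt lt_ja.
    rewrite proj_prodm_l proj_tup.
    rewrite (_ : split _ = inl (Ordinal lt_ja)); last first.
      by rewrite -[lshift _ _]/(unsplit (inl _)) unsplitK.
    rewrite proj_tup proj_tup cast_proj; congr proj; exact: val_inj.
  have lt : (j - a < n - a)%N by rewrite ltn_sub2r // (leq_ltn_trans le_aj).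
  have -> : cast_ord (esym e2) (lift a j) = rshift (a + 1)%N (Ordinal lt).
    by apply: val_inj; rewrite /= /bump le_aj addn1 addSn add1n subnKC.
  rewrite proj_prodm_r cmpf1 proj_tup cast_proj; congr proj; apply: val_inj.
  by rewrite /= /bump leq0n -addnA subnKC.
have -> : cast_ord (esym e2) a = lshift (n - a)%N (rshift a (ord0 : 'I_1)).
  by apply: val_inj; rewrite /= addn0.
rewrite proj_prodm_l proj_tup.
rewrite (_ : split _ = inr (ord0 : 'I_1)); last first.
  by rewrite -[rshift _ _]/(unsplit (inr _)) unsplitK.
rewrite proj_tup proj_tup cast_proj; congr proj; exact: val_inj.
Qed.

Lemma Emor_lift n (a : 'I_n.+1) (s : 'S_n) (e1 : (1 + a + (n - a) = n.+1)%N)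
    (e2 : (a + 1 + (n - a) = n.+1)%N) :
  Emor C (lift_perm ord0 a s)
  = castm e1 e2 (prodm (swapm C 1 a) (idm (n - a)%N)) \oc prodm (idm 1) (Emor C s).
Proof.
apply: tupE => i; rewrite cmpA proj_swap_cycle lift_permV.
case: unliftP => [j ->|->].
  rewrite lift_perm_lift.
  have -> : lift ord0 j = rshift 1 j by apply: val_inj.
  apply: (etrans (proj_prodm_r (idm 1) (Emor C s) j)).
  by rewrite !proj_tup; congr proj; apply: val_inj.
rewrite lift_perm_id.
have -> : @ord0 n = lshift n (ord0 : 'I_1) by apply: val_inj.
apply: (etrans (proj_prodm_l (idm 1) (Emor C s) ord0)).
by rewrite cmpf1 proj_prl.
Qed.

End LawvereSymmetry.

Definition castT (T : nat -> nat -> Type) m m' n n' (em : m = m') (en : n = n')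
    (x : T m n) : T m' n' := ecast n _ en (ecast m _ em x).
Arguments castT {T m m' n n'} em en x : simpl never.

(* A monad on the set nat with underlying matrix of modules T: T m n stands for
   T(m, n), which is the module of morphisms n -> m in the associated linear
   category. *)
Record monad_on (R : nzRingType) (T : nat -> nat -> lmodType R) := MonadOn {
  mcomp : forall l m n, T l m -> T m n -> T l n;
  mid : forall n, T n n;
  mcomp_linl : forall l m n (v : T m n), linear (fun u : T l m => mcomp u v);
  mcomp_linr : forall l m n (u : T l m), linear (fun v : T m n => mcomp u v);
  mcompA : forall k l m n (u : T k l) (v : T l m) (w : T m n),
    mcomp u (mcomp v w) = mcomp (mcomp u v) w;
  mcomp1l : forall m n (u : T m n), mcomp (mid m) u = u;
  mcomp1r : forall m n (u : T m n), mcomp u (mid n) = u }.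
Arguments mcomp {R T} _ {l m n}.

(* A linear PROP: a linear permutative category on nat with addition on
   objects, given through its monad, so that T m n consists of the morphisms
   n -> m. In particular psym m n : m + n -> n + m. The tensor product is
   strictly associative and unital, which needs transport along addnA and
   addn0 (0 + n is n by conversion). *)
Record prop_on (R : nzRingType) (T : nat -> nat -> lmodType R) := PropOn {
  pmonad :> monad_on T;
  ptens : forall m n m' n', T m n -> T m' n' -> T (m + m')%N (n + n')%N;
  psym : forall m n, T (n + m)%N (m + n)%N;
  ptens_linl : forall m n m' n' (v : T m' n'),
    linear (fun u : T m n => ptens u v);
  ptens_linr : forall m n m' n' (u : T m n),
    linear (fun v : T m' n' => ptens u v);
  ptens_comp : forall l m n l' m' n'
      (u : T l m) (v : T m n) (u' : T l' m') (v' : T m' n'),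
    ptens (mcomp pmonad u v) (mcomp pmonad u' v')
    = mcomp pmonad (ptens u u') (ptens v v');
  ptens_id : forall m n, ptens (mid pmonad m) (mid pmonad n) = mid pmonad (m + n);
  ptensA : forall m n m' n' m'' n'' (u : T m n) (v : T m' n') (w : T m'' n''),
    castT (T := T) (addnA m m' m'') (addnA n n' n'') (ptens u (ptens v w))
    = ptens (ptens u v) w;
  ptens0l : forall m n (u : T m n), ptens (mid pmonad 0) u = u;
  ptens0r : forall m n (u : T m n),
    castT (T := T) (addn0 m) (addn0 n) (ptens u (mid pmonad 0)) = u;
  psym_nat : forall m n m' n' (u : T m n) (v : T m' n'),
    mcomp pmonad (psym m m') (ptens u v) = mcomp pmonad (ptens v u) (psym n n');
  psymK : forall m n, mcomp pmonad (psym n m) (psym m n) = mid pmonad (m + n);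
  psym_hex : forall m n p,
    castT (T := T) (esym (addnA n p m)) (addnA m n p) (psym m (n + p))
    = mcomp pmonad (ptens (mid pmonad n) (psym m p))
        (castT (T := T) (esym (addnA n m p)) (erefl _) (ptens (psym m n) (mid pmonad p))) }.
Arguments ptens {R T} _ {m n m' n'}.
Arguments psym {R T} _ m n.

Lemma sum_ord0 (nu : 'I_0 -> nat) : (0 = \sum_(i < 0) nu i)%N.
Proof. by rewrite big_ord0. Qed.
Lemma sum_ordS m (nu : 'I_m.+1 -> nat) :
  (nu ord0 + \sum_(i < m) nu (lift ord0 i) = \sum_(i < m.+1) nu i)%N.
Proof. by rewrite big_ord_recl. Qed.

(* x_1 [x] ... [x] x_m, for x_i : nu_i -> 1, associated to the right. *)
Section IteratedTensor.
Variables (T : nat -> nat -> Type) (e : T 0%N 0%N).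
Variable t : forall m n m' n', T m n -> T m' n' -> T (m + m')%N (n + n')%N.

Fixpoint itens m : forall nu : 'I_m -> nat,
    (forall i, T 1%N (nu i)) -> T m (\sum_(i < m) nu i)%N :=
  match m with
  | 0 => fun nu _ => castT (erefl 0%N) (sum_ord0 nu) e
  | m'.+1 => fun nu x =>
      castT (erefl m'.+1) (sum_ordS nu)
        (t (x ord0) (itens (fun i => x (lift ord0 i))))
  end.
End IteratedTensor.

Section PropPerm.
Variables (R : nzRingType) (T : nat -> nat -> lmodType R) (P : prop_on T).

Definition ptensn m (nu : 'I_m -> nat) (x : forall i, T 1%N (nu i)) :
    T m (\sum_(i < m) nu i)%N :=
  itens (T := T) (mid P 0) (fun _ _ _ _ => ptens P) x.

Lemma cyc_src n (a : 'I_n.+1) : (1 + a + (n - a) = n.+1)%N.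
Proof. by rewrite -addnA subnKC // -ltnS. Qed.
Lemma cyc_tgt n (a : 'I_n.+1) : (a + 1 + (n - a) = n.+1)%N.
Proof. by rewrite [(a + 1)%N]addnC cyc_src. Qed.

(* The permutation s' such that s = lift_perm ord0 (s ord0) s'. *)
Definition perm_tail n (s : 'S_n.+1) : 'S_n :=
  odflt 1%g [pick s' | lift_perm ord0 (s ord0) s' == s].

Lemma perm_tailP n (s : 'S_n.+1) : lift_perm ord0 (s ord0) (perm_tail s) = s.
Proof.
rewrite /perm_tail; case: pickP => [s' /eqP //|no].
pose f (k : 'I_n) := odflt k (unlift (s ord0) (s (lift ord0 k))).
have fE k : lift (s ord0) (f k) = s (lift ord0 k).
  rewrite /f; case: unliftP => [j -> //|/perm_inj /eqP].
  by rewrite eq_sym (negPf (neq_lift _ _)).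
have f_inj : injective f.
  by move=> i j /(congr1 (lift (s ord0))); rewrite !fE => /perm_inj /lift_inj.
have := no (perm f_inj); rewrite (_ : _ == s) //; apply/eqP/permP => i.
by case: (unliftP ord0 i) => [j ->|->]; rewrite ?lift_perm_lift ?lift_perm_id // permE fE.
Qed.

(* The action 'S_n -> P(n, n) determined by the symmetry: the input i is sent to
   the output s i. The inputs other than the first one are permuted according to
   perm_tail s, and then the first one is moved past s(ord0) others. *)
Fixpoint pperm n : 'S_n -> T n n :=
  match n with
  | 0 => fun _ => mid P 0
  | n'.+1 => fun s =>
      let a := s ord0 in
      mcomp P
        (castT (T := T) (cyc_tgt a) (cyc_src a) (ptens P (psym P 1 a) (mid P (n' - a)%N)))
        (ptens P (mid P 1) (pperm (perm_tail s)))
  end.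
End PropPerm.

(* The structure maps of a linear operad. The operad axioms are not recorded:
   the only instances used below are underlying operads of PROPs. *)
Record operad_data (R : nzRingType) := OperadData {
  ocar : nat -> lmodType R;
  oact : forall n, ocar n -> 'S_n -> ocar n;
  ounit : ocar 1;
  ocomp : forall m (nu : 'I_m -> nat),
    ocar m -> (forall i, ocar (nu i)) -> ocar (\sum_(i < m) nu i)%N }.

(* The underlying operad n |-> P(n, 1) of a PROP. *)
Definition operad_of (R : nzRingType) (T : nat -> nat -> lmodType R) (P : prop_on T) :
    operad_data R :=
  {| ocar := T 1%N;
     oact n x s := mcomp P x (pperm P s);
     ounit := mid P 1;
     ocomp m nu x y := mcomp P x (ptensn P y) |}.

Section Phi.
Variables (R : comNzRingType) (C : lawvere) (Z : zero_object C).

(* L_C(m, n) = R[C(n, m)]. *)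
Definition L (m n : nat) : lmodType R := {malg R[hom C n m]}.

Definition lcomp l m n : L l m -> L m n -> L l n :=
  flin2 (fun f g => << f \oc g >> : L l n).
Definition ltens m n m' n' : L m n -> L m' n' -> L (m + m')%N (n + n')%N :=
  flin2 (fun f g => << prodm f g >> : L (m + m') (n + n')).

Definition eta := zmor Z 0 1.
(* Bar Delta^{n,k} with n = a + 1 + b and k = a + 1. The bracketing
   id_a x (id_1 x eta) x id_b of id_k x eta x id_{n-k}, and likewise for the last
   term, has the expected source and target by conversion. *)
Definition dbar a b : L (a + 2 + b)%N (a + 1 + b)%N :=
  << prodm (prodm (idm a) (diag C)) (idm b) >>
  - << prodm (prodm (idm a) (prodm (idm 1) eta)) (idm b) >>
  - << prodm (prodm (idm a) (prodm eta (idm 1))) (idm b) >>.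

Inductive Ipr_gen m : forall n, L m n -> Prop :=
| IprGen a b (f : L m (a + 2 + b)%N) : Ipr_gen (lcomp f (dbar a b)).

Definition Ipr m n : submod (L m n) := span_sm (@Ipr_gen m n).

Lemma lcomp_linl l m n (v : L m n) : linear (fun u : L l m => lcomp u v).
Proof. exact: flin2_linl. Qed.
Lemma lcomp_linr l m n (u : L l m) : linear (fun v : L m n => lcomp u v).
Proof. exact: flin2_linr. Qed.
Lemma ltens_linl m n m' n' (v : L m' n') : linear (fun u : L m n => ltens u v).
Proof. exact: flin2_linl. Qed.
Lemma ltens_linr m n m' n' (u : L m n) : linear (fun v : L m' n' => ltens u v).
Proof. exact: flin2_linr. Qed.
Lemma lcompU l m n (f : hom C m l) (g : hom C n m) :
  lcomp << f >> << g >> = << f \oc g >> :> L l n.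
Proof. exact: flin2U. Qed.
Lemma ltensU m n m' n' (f : hom C n m) (g : hom C n' m') :
  ltens << f >> << g >> = << prodm f g >> :> L _ _.
Proof. exact: flin2U. Qed.

Lemma lcompA k l m n (u : L k l) (v : L l m) (w : L m n) :
  lcomp u (lcomp v w) = lcomp (lcomp u v) w.
Proof.
move: u; apply: lin_ext => [a x y|a x y|f]; rewrite ?lcomp_linl //.
move: v; apply: lin_ext => [a x y|a x y|g]; rewrite ?(lcomp_linl, lcomp_linr) //.
move: w; apply: lin_ext => [a x y|a x y|h]; rewrite ?(lcomp_linl, lcomp_linr) //.
by rewrite !lcompU cmpA.
Qed.
Lemma lcomp1l m n (u : L m n) : lcomp << idm m >> u = u.
Proof.
move: u; apply: lin_ext => [a x y|a x y|f]; rewrite ?lcomp_linr //.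
by rewrite lcompU cmp1f.
Qed.
Lemma lcomp1r m n (u : L m n) : lcomp u << idm n >> = u.
Proof.
move: u; apply: lin_ext => [a x y|a x y|f]; rewrite ?lcomp_linl //.
by rewrite lcompU cmpf1.
Qed.
Lemma ltens_comp l m n l' m' n' (u : L l m) (v : L m n) (u' : L l' m') (v' : L m' n') :
  ltens (lcomp u v) (lcomp u' v') = lcomp (ltens u u') (ltens v v').
Proof.
move: u; apply: lin_ext => [a x y|a x y|f]; rewrite ?(lcomp_linl, ltens_linl) //.
move: v; apply: lin_ext => [a x y|a x y|g]; rewrite ?(lcomp_linr, ltens_linl) //.
move: u'; apply: lin_ext => [a x y|a x y|f']; rewrite ?(lcomp_linl, ltens_linr, lcomp_linr) ?lcomp_linl //.
move: v'; apply: lin_ext => [a x y|a x y|g']; rewrite ?(lcomp_linl, ltens_linr, lcomp_linr) //.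
by rewrite !(lcompU, ltensU) prodm_comp.
Qed.
Lemma ltens_id m n : ltens << idm m >> << idm n >> = << idm (m + n) >>.
Proof. by rewrite ltensU prodm1. Qed.

Lemma castL_lin m m' n n' (em : m = m') (en : n = n') :
  linear (castT (T := L) em en : L m n -> L m' n').
Proof. by case: m' / em; case: n' / en. Qed.
Lemma castLU m m' n n' (em : m = m') (en : n = n') (f : hom C n m) :
  castT (T := L) em en << f >> = << castm en em f >>.
Proof. by case: m' / em; case: n' / en. Qed.
Lemma ltensA m n m' n' m'' n'' (u : L m n) (v : L m' n') (w : L m'' n'') :
  castT (T := L) (addnA m m' m'') (addnA n n' n'') (ltens u (ltens v w))
    = ltens (ltens u v) w.
Proof.
move: u; apply: lin_ext => [a x y|a x y|f]; rewrite ?ltens_linl ?castL_lin ?ltens_linl //.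
move: v; apply: lin_ext => [a x y|a x y|g]; rewrite ?(ltens_linl, ltens_linr) ?castL_lin ?ltens_linl //.
move: w; apply: lin_ext => [a x y|a x y|h]; rewrite ?(ltens_linl, ltens_linr) ?castL_lin ?ltens_linl //.
by rewrite !ltensU castLU prodmA.
Qed.
Lemma ltens0l m n (u : L m n) : ltens << idm 0 >> u = u.
Proof.
move: u; apply: lin_ext => [a x y|a x y|f]; rewrite ?ltens_linr //.
by rewrite ltensU prod0m.
Qed.
Lemma ltens0r m n (u : L m n) :
  castT (T := L) (addn0 m) (addn0 n) (ltens u << idm 0 >>) = u.
Proof.
move: u; apply: lin_ext => [a x y|a x y|f]; rewrite ?ltens_linl ?castL_lin //.
by rewrite ltensU castLU prodm0.
Qed.
Lemma lswap_nat m n m' n' (u : L m n) (v : L m' n') :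
  lcomp << swapm C m m' >> (ltens u v) = lcomp (ltens v u) << swapm C n n' >>.
Proof.
move: u; apply: lin_ext => [a x y|a x y|f]; rewrite ?(ltens_linl, ltens_linr) ?(lcomp_linl, lcomp_linr) //.
move: v; apply: lin_ext => [a x y|a x y|g]; rewrite ?(ltens_linl, ltens_linr) ?(lcomp_linl, lcomp_linr) //.
by rewrite !(ltensU, lcompU) swap_nat.
Qed.

Lemma castTK (T : nat -> nat -> Type) m m' n n' (em : m = m') (en : n = n') (x : T m n) :
  castT (esym em) (esym en) (castT em en x) = x.
Proof. by case: m' / em; case: n' / en. Qed.
Lemma castT_id (T : nat -> nat -> Type) m n (em : m = m) (en : n = n) (x : T m n) :
  castT em en x = x.
Proof. by rewrite (eq_irrelevance em erefl) (eq_irrelevance en erefl). Qed.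
Lemma castT_trans (T : nat -> nat -> Type) m m' m'' n n' n'' (em : m = m') (en : n = n')
    (em' : m' = m'') (en' : n' = n'') (x : T m n) :
  castT em' en' (castT em en x) = castT (etrans em em') (etrans en en') x.
Proof. by case: m'' / em'; case: n'' / en'. Qed.
Lemma lcomp_cast l l' m m' n n' (el : l = l') (em : m = m') (en : n = n')
    (u : L l m) (v : L m n) :
  lcomp (castT (T := L) el em u) (castT (T := L) em en v) = castT (T := L) el en (lcomp u v).
Proof. by case: l' / el; case: m' / em; case: n' / en. Qed.
Lemma ltens_castl m m' n n' p q (em : m = m') (en : n = n') (u : L m n) (v : L p q) :
  ltens (castT (T := L) em en u) v =
  castT (T := L) (congr1 (addn^~ p) em) (congr1 (addn^~ q) en) (ltens u v).
Proof. by case: m' / em; case: n' / en. Qed.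
Lemma ltens_castr m m' n n' p q (em : m = m') (en : n = n') (u : L m n) (v : L p q) :
  ltens v (castT (T := L) em en u) =
  castT (T := L) (congr1 (addn p) em) (congr1 (addn q) en) (ltens v u).
Proof. by case: m' / em; case: n' / en. Qed.

Lemma Ipr_cast m m' n n' (em : m = m') (en : n = n') (u : L m n) :
  (castT (T := L) em en u \in Ipr m' n') = (u \in Ipr m n).
Proof. by case: m' / em; case: n' / en. Qed.

Lemma Ipr_genP m n (x : L m n) : Ipr_gen x ->
  exists a b (e : (a + 1 + b = n)%N) (f : L m (a + 2 + b)%N),
    x = lcomp f (castT (T := L) erefl e (dbar a b)).
Proof. by case=> a b f; exists a, b, erefl, f; rewrite castT_id. Qed.

Lemma Ipr_gen_mem m n a b (e : (a + 1 + b = n)%N) (f : L m (a + 2 + b)%N) :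
  lcomp f (castT (T := L) erefl e (dbar a b)) \in Ipr m n.
Proof. by case: n / e; apply: mem_span. Qed.

Lemma dbar_mem a b n (e : (a + 1 + b = n)%N) :
  castT (T := L) erefl e (dbar a b) \in Ipr _ n.
Proof. by rewrite -[castT _ _ _]lcomp1l Ipr_gen_mem. Qed.

Lemma Ipr_rect m n (P : L m n -> Prop) :
  P 0 -> (forall a u v, P u -> P v -> P (a *: u + v)) ->
  (forall a b (e : (a + 1 + b = n)%N) (f : L m (a + 2 + b)%N),
    P (lcomp f (castT (T := L) erefl e (dbar a b)))) ->
  forall u, u \in Ipr m n -> P u.
Proof.
move=> P0 PD Pg u /spanP; elim=> // a x v /Ipr_genP[c [d [e [f ->]]]] _ Pv.
exact: PD.
Qed.

Lemma Ipr_left l m n (u : L l m) (v : L m n) : v \in Ipr m n -> lcomp u v \in Ipr l n.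
Proof.
move: v; apply: Ipr_rect => [|a x y|a b e f].
- have -> : lcomp u 0 = 0 :> L l n.
    exact: (lin0 (lcomp_linr u)).
  exact: (sm_closed _).1.
- by rewrite lcomp_linr; apply: (sm_closed _).2.
by rewrite lcompA Ipr_gen_mem.
Qed.

Definition lD : L 2 1 := << diag C >> - << prodm (idm 1) eta >> - << prodm eta (idm 1) >>.
Lemma ltensBr m n p q (u : L m n) (v w : L p q) : ltens u (v - w) = ltens u v - ltens u w.
Proof. by rewrite addrC -scaleN1r ltens_linr scaleN1r addrC. Qed.
Lemma ltensBl m n p q (u : L m n) (v w : L p q) : ltens (v - w) u = ltens v u - ltens w u.
Proof. by rewrite addrC -scaleN1r ltens_linl scaleN1r addrC. Qed.
Lemma dbarE a b : dbar a b = ltens (ltens << idm a >> lD) << idm b >>.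
Proof. by rewrite /lD !ltensBr !ltensBl !ltensU. Qed.

Lemma dbar_tensr a b p :
  castT (T := L) (addnA _ _ _) (addnA _ _ _) (dbar a (b + p)%N) = ltens (dbar a b) << idm p >>.
Proof. by rewrite !dbarE -[RHS]ltensA ltens_id. Qed.
Lemma dbar_tensl a b p e e' :
  castT (T := L) e e' (dbar (p + a)%N b) = ltens << idm p >> (dbar a b).
Proof.
rewrite !dbarE -[RHS](castTK (T := L) (addnA _ _ _) (addnA _ _ _)) ltensA.
rewrite -[ltens << idm p >> (ltens _ lD)]
  (castTK (T := L) (addnA _ _ _) (addnA _ _ _)) ltensA ltens_id.
rewrite ltens_castl !castT_trans.
by congr castT; apply: eq_irrelevance.
Qed.

Lemma dbar_split a b m p (e : (a + 1 + b = m + p)%N) :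
  (exists q (x : L q m) (e' : (a + 2 + b = q + p)%N),
     x \in Ipr q m /\ castT (T := L) e' e (dbar a b) = ltens x << idm p >>) \/
  (exists q (x : L q p) (e' : (a + 2 + b = m + q)%N),
     x \in Ipr q p /\ castT (T := L) e' e (dbar a b) = ltens << idm m >> x).
Proof.
have [lt_am|le_ma] := ltnP a m.
  left; have [c em] : exists c, m = (a + 1 + c)%N.
    by exists (m - (a + 1))%N; rewrite subnKC // addn1.
  subst m; have eb : b = (c + p)%N.
    by apply: (@addnI (a + 1)); rewrite e addnA.
  subst b; exists (a + 2 + c)%N, (dbar a c), (addnA _ _ _); split.
    by rewrite -(castT_id (T := L) erefl erefl (dbar a c)) dbar_mem.
  by rewrite -dbar_tensr (eq_irrelevance e (addnA _ _ _)).
right; have [c ea] : exists c, a = (m + c)%N by exists (a - m)%N; rewrite subnKC.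
subst a; have ep : p = (c + 1 + b)%N.
  by apply: (@addnI m); rewrite -e !addnA.
subst p; exists (c + 2 + b)%N, (dbar c b).
have e' : (m + c + 2 + b = m + (c + 2 + b))%N by rewrite !addnA.
exists e'; split; last exact: dbar_tensl.
by rewrite -(castT_id (T := L) erefl erefl (dbar c b)) dbar_mem.
Qed.

Lemma Ipr_tensl m n m' n' (u : L m n) (v : L m' n') :
  u \in Ipr m n -> ltens u v \in Ipr _ _.
Proof.
move: u; apply: Ipr_rect => [|a x y|a b e f].
- have -> : ltens 0 v = 0 :> L (m + m') (n + n').
    exact: (lin0 (ltens_linl v)).
  exact: (sm_closed _).1.
- by rewrite ltens_linl; apply: (sm_closed _).2.
rewrite -[v]lcomp1r ltens_comp; apply: Ipr_left.
by rewrite ltens_castl -dbar_tensr castT_trans Ipr_cast -[dbar _ _](castT_id (T := L) erefl erefl) dbar_mem.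
Qed.
Lemma Ipr_tensr m n m' n' (u : L m n) (v : L m' n') :
  v \in Ipr m' n' -> ltens u v \in Ipr _ _.
Proof.
move: v; apply: Ipr_rect => [|a x y|a b e f].
- have -> : ltens u 0 = 0 :> L (m + m') (n + n').
    exact: (lin0 (ltens_linr u)).
  exact: (sm_closed _).1.
- by rewrite ltens_linr; apply: (sm_closed _).2.
rewrite -[u]lcomp1r ltens_comp; apply: Ipr_left.
have e1 : (n + a + 2 + b = n + (a + 2 + b))%N by rewrite !addnA.
have e2 : (n + a + 1 + b = n + (a + 1 + b))%N by rewrite !addnA.
by rewrite ltens_castr -(dbar_tensl e1 e2) castT_trans Ipr_cast -[dbar _ _](castT_id (T := L) erefl erefl) dbar_mem.
Qed.

Definition eig_pred m n : {pred L m n} := fun f =>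
  `[< forall l (h : L l m), h \in Ipr l m -> lcomp h f \in Ipr l n >].
Lemma eig_closed m n : submod_closed (@eig_pred m n).
Proof.
split=> [|a u v /asboolP Au /asboolP Av]; apply/asboolP => l h Ih.
  have -> : lcomp h 0 = 0 :> L l n.
    exact: (lin0 (lcomp_linr h)).
  exact: (sm_closed _).1.
by rewrite lcomp_linr; apply: (sm_closed _).2; [apply: Au | apply: Av].
Qed.
Definition eig m n : submod (L m n) := Submod (@eig_closed m n).
Definition Phi m n : lmodType R := subquot (eig m n) (Ipr m n).

Lemma eigP m n (f : L m n) :
  f \in eig m n <-> (forall l (h : L l m), h \in Ipr l m -> lcomp h f \in Ipr l n).
Proof. by split=> [/asboolP|?]; last exact/asboolP. Qed.

Lemma eig_gen m n (f : L m n) :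
  (forall a b (e : (a + 1 + b = m)%N),
     lcomp (castT (T := L) erefl e (dbar a b)) f \in Ipr _ n) -> f \in eig m n.
Proof.
move=> H; apply/eigP => l; apply: Ipr_rect => [|a x y|a b e g].
- have -> : lcomp 0 f = 0 :> L l n.
    exact: (lin0 (lcomp_linl f)).
  exact: (sm_closed _).1.
- by rewrite lcomp_linl; apply: (sm_closed _).2.
by rewrite -lcompA Ipr_left.
Qed.

Lemma eig_comp l m n (u : L l m) (v : L m n) :
  u \in eig l m -> v \in eig m n -> lcomp u v \in eig l n.
Proof.
by move=> /eigP Au /eigP Av; apply/eigP => k h Ih; rewrite lcompA; apply/Av/Au.
Qed.
Lemma eig_id n : << idm n >> \in eig n n.
Proof. by apply/eigP => l h Ih; rewrite lcomp1r. Qed.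
Lemma eig_cast m m' n n' (em : m = m') (en : n = n') (u : L m n) :
  (castT (T := L) em en u \in eig m' n') = (u \in eig m n).
Proof. by case: m' / em; case: n' / en. Qed.

Lemma lcomp_cast_mem k k' m m' n (ek : k = k') (em : m = m') (d : L k m) (f : L m' n) :
  (lcomp (castT (T := L) erefl em d) f \in Ipr _ n)
  = (lcomp (castT (T := L) ek em d) f \in Ipr _ n).
Proof. by case: k' / ek. Qed.

Lemma eig_tens m n m' n' (u : L m n) (u' : L m' n') :
  u \in eig m n -> u' \in eig m' n' -> ltens u u' \in eig _ _.
Proof.
move=> /eigP Au /eigP Au'; apply: eig_gen => a b e.
have [[q [x [e' [Ix E]]]]|[q [x [e' [Ix E]]]]] := dbar_split e;
  rewrite (lcomp_cast_mem e') E -ltens_comp.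
  by apply: Ipr_tensl; apply: Au.
by apply: Ipr_tensr; apply: Au'.
Qed.

Lemma eig_swap m n : << swapm C m n >> \in eig (n + m) (m + n).
Proof.
apply: eig_gen => a b e.
have [[q [x [e' [Ix E]]]]|[q [x [e' [Ix E]]]]] := dbar_split e;
  rewrite (lcomp_cast_mem e') E -lswap_nat Ipr_left //.
  exact: Ipr_tensr.
exact: Ipr_tensl.
Qed.

Lemma eig_E n (s : 'S_n) : << Emor C s >> \in eig n n.
Proof.
elim: n s => [|n IH] s.
  by rewrite (_ : Emor C s = idm 0) ?eig_id //; apply: proj_ext; case.
rewrite -(perm_tailP s) (Emor_lift _ _ (cyc_src _) (cyc_tgt _)) -lcompU -castLU.
apply: eig_comp; first by rewrite eig_cast -ltensU eig_tens ?eig_swap ?eig_id.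
by have := eig_tens (eig_id 1) (IH (perm_tail s)); rewrite ltensU; apply.
Qed.

Definition cls m n (f : L m n) (Af : f \in eig m n) : Phi m n := scls _ Af.

(* [u] o [v] = [u o v] and [u] [x] [v] = [u x v], see phi_compE and phi_tensE. *)
Definition phi_comp l m n : Phi l m -> Phi m n -> Phi l n :=
  sqmap2 (@eig_comp l m n).
Definition phi_tens m n m' n' : Phi m n -> Phi m' n' -> Phi (m + m')%N (n + n')%N :=
  sqmap2 (@eig_tens m n m' n').

Lemma Ipr_comp l m n (u : L l m) (v : L m n) :
  u \in Ipr l m -> v \in eig m n -> lcomp u v \in Ipr l n.
Proof. by move=> Iu /eigP; apply. Qed.

Lemma phi_compE l m n u v (Au : u \in eig l m) (Av : v \in eig m n) :
  phi_comp (cls Au) (cls Av) = cls (eig_comp Au Av).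
Proof.
apply: sqmap2E; [exact: lcomp_linl | exact: lcomp_linr | exact: Ipr_comp |].
by move=> ? ? _; apply: Ipr_left.
Qed.
Lemma phi_tensE m n m' n' u v (Au : u \in eig m n) (Av : v \in eig m' n') :
  phi_tens (cls Au) (cls Av) = cls (eig_tens Au Av).
Proof.
apply: sqmap2E; [exact: ltens_linl | exact: ltens_linr | |].
  by move=> ? ? ? _; apply: Ipr_tensl.
by move=> ? ? _; apply: Ipr_tensr.
Qed.
Lemma clsP m n (x : Phi m n) : exists u (Au : u \in eig m n), x = cls Au.
Proof. exact: sclsP. Qed.
Lemma cls_congr m n u v (Au : u \in eig m n) (Av : v \in eig m n) :
  u = v -> cls Au = cls Av.
Proof. by move=> e; apply/scls_eq; rewrite e subrr (sm_closed _).1. Qed.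
Lemma castT_cls m m' n n' (em : m = m') (en : n = n') u (Au : u \in eig m n)
    (Au' : castT (T := L) em en u \in eig m' n') :
  castT (T := Phi) em en (cls Au) = cls Au'.
Proof.
by case: m' / em Au'; case: n' / en => Au'; apply: cls_congr.
Qed.

Definition Phi_monad : monad_on Phi.
refine {| mcomp := phi_comp; mid n := cls (eig_id n) |}.
- move=> l m n v; apply: sqmap2_linl; [exact: lcomp_linl | exact: lcomp_linr | exact: Ipr_comp |].
  by move=> ? ? _; apply: Ipr_left.
- move=> l m n v; apply: sqmap2_linr; [exact: lcomp_linl | exact: lcomp_linr | exact: Ipr_comp |].
  by move=> ? ? _; apply: Ipr_left.
- move=> k l m n u v w; have [{}u [Au ->]] := clsP u; have [{}v [Av ->]] := clsP v.
  by have [{}w [Aw ->]] := clsP w; rewrite !phi_compE; apply: cls_congr; apply: lcompA.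
- move=> m n u; have [{}u [Au ->]] := clsP u.
  by rewrite phi_compE; apply: cls_congr; apply: lcomp1l.
- move=> m n u; have [{}u [Au ->]] := clsP u.
  by rewrite phi_compE; apply: cls_congr; apply: lcomp1r.
Defined.

Definition Phi_prop : prop_on Phi.
refine {| pmonad := Phi_monad; ptens := phi_tens; psym m n := cls (eig_swap m n) |}.
- move=> m n m' n' v; apply: sqmap2_linl; [exact: ltens_linl | exact: ltens_linr | |].
    by move=> ? ? ? _; apply: Ipr_tensl.
  by move=> ? ? _; apply: Ipr_tensr.
- move=> m n m' n' v; apply: sqmap2_linr; [exact: ltens_linl | exact: ltens_linr | |].
    by move=> ? ? ? _; apply: Ipr_tensl.
  by move=> ? ? _; apply: Ipr_tensr.
- move=> l m n l' m' n' u v u' v' /=.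
  have [{}u [Au ->]] := clsP u; have [{}v [Av ->]] := clsP v.
  have [{}u' [Au' ->]] := clsP u'; have [{}v' [Av' ->]] := clsP v'.
  by rewrite !(phi_compE, phi_tensE); apply: cls_congr; apply: ltens_comp.
- by move=> m n /=; rewrite phi_tensE; apply: cls_congr; apply: ltens_id.
- move=> m n m' n' m'' n'' u v w; have [{}u [Au ->]] := clsP u.
  have [{}v [Av ->]] := clsP v; have [{}w [Aw ->]] := clsP w.
  rewrite !phi_tensE castT_cls; first by rewrite eig_cast; do !apply: eig_tens.
  by move=> H; apply: cls_congr; apply: ltensA.
- move=> m n u /=; have [{}u [Au ->]] := clsP u.
  by rewrite phi_tensE; apply: cls_congr; apply: ltens0l.
- move=> m n u /=; have [{}u [Au ->]] := clsP u.
  rewrite !phi_tensE castT_cls; first by rewrite eig_cast; apply: eig_tens (eig_id _).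
  by move=> H; apply: cls_congr; apply: ltens0r.
- move=> m n m' n' u v /=; have [{}u [Au ->]] := clsP u; have [{}v [Av ->]] := clsP v.
  by rewrite !(phi_compE, phi_tensE); apply: cls_congr; apply: lswap_nat.
- by move=> m n /=; rewrite phi_compE; apply: cls_congr; rewrite lcompU swapK.
- move=> m n p /=.
  rewrite !phi_tensE !castT_cls; try by rewrite eig_cast ?eig_tens ?eig_id ?eig_swap.
  move=> H H'; rewrite phi_compE; apply: cls_congr.
  by rewrite !ltensU !castLU lcompU swap_hex.
Defined.
End Phi.

Lemma inj_surj_bij (T : choiceType) (U : eqType) (f : T -> U) :
  injective f -> (forall y, exists x, f x = y) -> bijective f.
Proof.
move=> f_inj f_surj.
have ex y : exists x, f x == y by have [x <-] := f_surj y; exists x.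
by exists (fun y => xchoose (ex y)) => [x|y]; [apply: f_inj|];
   apply/eqP/(xchooseP (ex _)).
Qed.

Lemma bij_surj (T U : Type) (f : T -> U) : bijective f -> forall y, exists x, f x = y.
Proof. by move=> [g fK gK] y; exists (g y). Qed.

Lemma bij_tagmap (I J : finType) (T : J -> finType) (f : I -> J) :
  bijective f ->
  bijective (fun p : {i & T (f i)} => Tagged T (tagged p) : {j & T j}).
Proof.
move=> [g fK gK]; apply: inj_surj_bij => [[i x] [i' x'] /= e|[j y]].
  have /(can_inj fK) ei : f i = f i' := congr1 tag e.
  by subst i'; have /eqP := e; rewrite eq_Tagged => /eqP /= ->.
by rewrite -(gK j) in y *; exists (Tagged (fun i => T (f i)) y).
Qed.

Section Mu.
Variables (R : comNzRingType) (O : operad_data R).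

(* Generators of mu O (m, n): a decomposition n_1 + ... + n_m = n, operations
   x_i in O(n_i) and a permutation s of n letters. The pair of the decomposition
   and s is encoded by the bijection lab from the disjoint union of the
   {1, ..., n_i} to {1, ..., n} that gives the input plugged into each entry of
   each x_i: lab i j = s^-1 (n_1 + ... + n_(i-1) + j), see mu_tensor. The images
   of the lab i are the fibres of the function f : {1..n} -> {1..m} that indexes
   the second description of mu O. *)
Record mu_gen m n := MuGen {
  ar : 'I_m -> nat;
  ops : forall i, ocar O (ar i);
  lab : forall i, 'I_(ar i) -> 'I_n;
  lab_bij : bijective (fun p : {i & 'I_(ar i)} => lab (tagged p)) }.
HB.instance Definition _ m n := gen_eqMixin (mu_gen m n).
HB.instance Definition _ m n := gen_choiceMixin (mu_gen m n).
Arguments MuGen {m n ar} ops lab lab_bij.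
Arguments lab {m n} _ i j.

(* Relations of the tensor product: multilinearity (MuLin), and
     (x_1 <| t_1) (x) ... (x) (x_m <| t_m) (x) s
       = x_1 (x) ... (x) x_m (x) (t_1 x ... x t_m) s     (MuAct)
   where, in terms of lab, s^-1 = ((t_1 x ... x t_m) s)^-1 (t_1 x ... x t_m). *)
Inductive mu_rel m n : {malg R[mu_gen m n]} -> Prop :=
| MuLin (nu : 'I_m -> nat) (x : forall i, ocar O (nu i))
    (l : forall i, 'I_(nu i) -> 'I_n)
    (bl : bijective (fun p : {i & 'I_(nu i)} => l _ (tagged p)))
    (i : 'I_m) (a : R) (u v : ocar O (nu i)) :
    mu_rel (<< MuGen (dfwith x (a *: u + v)) l bl >>
            - (a *: << MuGen (dfwith x u) l bl >> + << MuGen (dfwith x v) l bl >>))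
| MuAct (nu : 'I_m -> nat) (x : forall i, ocar O (nu i))
    (t : forall i, 'S_(nu i)) (l : forall i, 'I_(nu i) -> 'I_n)
    (bl : bijective (fun p : {i & 'I_(nu i)} => l _ (tagged p)))
    (blt : bijective (fun p : {i & 'I_(nu i)} => l _ (t _ (tagged p)))) :
    mu_rel (<< MuGen (fun i => oact (x i) (t i)) (fun i j => l i (t i j)) blt >>
            - << MuGen x l bl >>).

Definition mu m n : lmodType R := qmod (span_sm (@mu_rel m n)).
Definition mu_cls m n (g : mu_gen m n) : mu m n := qcls _ << g >>.

Section Block.
Variables (m : nat) (nu : 'I_m -> nat) (x : forall i, ocar O (nu i)).
Variable s : 'S_(\sum_(i < m) nu i).
Definition block_lab i (j : 'I_(nu i)) := (s^-1)%g (@tagnat.Rank m nu i j).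
Lemma block_lab_bij : bijective (fun p : {i & 'I_(nu i)} => block_lab (tagged p)).
Proof.
exists (fun i => tagnat.sig (s i)) => [[i j]|i]; rewrite /block_lab ?permKV.
  by rewrite /tagnat.Rank tagnat.rankK.
by rewrite -tagnat.rankE tagnat.sigK permK.
Qed.
Definition mu_tensor : mu m (\sum_(i < m) nu i)%N := mu_cls (MuGen x block_lab block_lab_bij).
End Block.

(* Composition of generators induced by the operad composition: the entry (i, a)
   of g receives the operation of h at the index lab g i a. *)
Section GenComp.
Variables (l m n : nat) (g : mu_gen l m) (h : mu_gen m n).
Definition gcomp_ar (i : 'I_l) : nat := (\sum_(a < ar g i) ar h (lab g i a))%N.
Definition gcomp_ops i : ocar O (gcomp_ar i) :=
  ocomp (ops g i) (fun a => ops h (lab g i a)).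
Definition gcomp_lab i (c : 'I_(gcomp_ar i)) : 'I_n :=
  lab h (lab g i (tagnat.sig1 c)) (tagnat.sig2 c).
Lemma gcomp_lab_bij :
  bijective (fun p : {i & 'I_(gcomp_ar i)} => gcomp_lab (tagged p)).
Proof.
pose f (q : {i & 'I_(ar g i)}) := lab g _ (tagged q).
pose S := {q : {i & 'I_(ar g i)} & 'I_(ar h (f q))}.
pose mk i (c : 'I_(gcomp_ar i)) : S :=
  Tagged (fun q => 'I_(ar h (f q)))
    (tagnat.sig2 c : 'I_(ar h (f (Tagged (fun i => 'I_(ar g i)) (tagnat.sig1 c))))).
pose back (z : S) : {i & 'I_(gcomp_ar i)} :=
  let: existT (existT i a) b := z in
  Tagged (fun i => 'I_(gcomp_ar i))
    (@tagnat.Rank _ (fun a => ar h (lab g i a)) a b).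
apply: inj_surj_bij => [[i c] [i' c'] e|t].
  have : mk i c = mk i' c'.
    apply: (bij_inj (bij_tagmap (fun j => 'I_(ar h j)) (lab_bij g))).
    by apply: (bij_inj (lab_bij h)).
  by move/(congr1 back) => /=; rewrite !tagnat.sig2K.
have [[j b] <-] := bij_surj (lab_bij h) t.
have [[i a] /= ej] := bij_surj (lab_bij g) j; subst j.
exists (back (Tagged (fun q => 'I_(ar h (f q)))
  (b : 'I_(ar h (f (Tagged (fun i => 'I_(ar g i)) a)))))) => /=.
rewrite /gcomp_lab /tagnat.sig1 /tagnat.sig2 /tagnat.Rank.
by rewrite tagnat.rankK.
Qed.
Definition gcomp : mu_gen l n := MuGen gcomp_ops gcomp_lab gcomp_lab_bij.
End GenComp.

Section GenUnit.
Variables (m n : nat) (f : 'I_m -> 'I_n) (f_bij : bijective f).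
Lemma gunit_lab_bij : bijective (fun p : {_ : 'I_m & 'I_1} => f (tag p)).
Proof.
apply: inj_surj_bij => [[i a] [j b] /= /(bij_inj f_bij)|t].
  by move=> -> /=; rewrite (ord1 a) (ord1 b).
by have [i <-] := bij_surj f_bij t; exists (@Tagged _ i (fun=> 'I_1) ord0).
Qed.
Definition gunit : mu_gen m n :=
  MuGen (ar := fun=> 1%N) (fun=> ounit O) (fun i _ => f i) gunit_lab_bij.
End GenUnit.

Definition gid n : mu_gen n n := gunit (Bijective (g := id) (frefl id) (frefl id)).

Definition blockswap m n (i : 'I_(n + m)) : 'I_(m + n) :=
  match split i with inl a => rshift m a | inr b => lshift n b end.
Lemma blockswapK m n : cancel (@blockswap m n) (@blockswap n m).
Proof.
move=> i; rewrite /blockswap -{2}[i]splitK; case: (split i) => j.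
  by rewrite -[rshift _ _]/(unsplit (inr _)) unsplitK.
by rewrite -[lshift _ _]/(unsplit (inl _)) unsplitK.
Qed.
Definition gsym m n : mu_gen (n + m) (m + n) :=
  gunit (Bijective (@blockswapK m n) (@blockswapK n m)).

Section GenTensor.
Variables (m n m' n' : nat) (g : mu_gen m n) (g' : mu_gen m' n').
Definition sum_ar (z : 'I_m + 'I_m') : nat :=
  match z with inl a => ar g a | inr b => ar g' b end.
Definition sum_ops (z : 'I_m + 'I_m') : ocar O (sum_ar z) :=
  match z with inl a => ops g a | inr b => ops g' b end.
Definition sum_lab (z : 'I_m + 'I_m') : 'I_(sum_ar z) -> 'I_(n + n') :=
  match z with
  | inl a => fun j => lshift n' (lab g a j)
  | inr b => fun j => rshift n (lab g' b j)
  end.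
Lemma sum_lab_bij : bijective (fun p : {z & 'I_(sum_ar z)} => sum_lab (tagged p)).
Proof.
apply: inj_surj_bij => [[[a|a] j] [[b|b] k] /=|t].
- move/lshift_inj => e; have /(_ (@Tagged _ a (fun i => 'I_(ar g i)) j) (@Tagged _ b (fun i => 'I_(ar g i)) k) e)
    := bij_inj (lab_bij g).
  by move/(congr1 (fun p : {i & 'I_(ar g i)} =>
                    @Tagged _ (inl (tag p)) (fun z => 'I_(sum_ar z)) (tagged p))).
- by move/eqP; rewrite eq_lrshift.
- by move/eqP; rewrite eq_rlshift.
- move/rshift_inj => e; have /(_ (@Tagged _ a (fun i => 'I_(ar g' i)) j) (@Tagged _ b (fun i => 'I_(ar g' i)) k) e)
    := bij_inj (lab_bij g').
  by move/(congr1 (fun p : {i & 'I_(ar g' i)} =>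
                    @Tagged _ (inr (tag p)) (fun z => 'I_(sum_ar z)) (tagged p))).
rewrite -(splitK t); case: (split t) => u.
  have [[a j] /= <-] := bij_surj (lab_bij g) u.
  by exists (@Tagged _ (inl a) (fun z => 'I_(sum_ar z)) j).
have [[a j] /= <-] := bij_surj (lab_bij g') u.
by exists (@Tagged _ (inr a) (fun z => 'I_(sum_ar z)) j).
Qed.
Lemma gtens_lab_bij :
  bijective (fun p : {i : 'I_(m + m') & 'I_(sum_ar (split i))} => sum_lab (tagged p)).
Proof.
have split_bij : bijective (@split m m') by exists unsplit; [apply: splitK|apply: unsplitK].
exact: bij_comp sum_lab_bij (bij_tagmap (fun z => 'I_(sum_ar z)) split_bij).
Qed.
Definition gtens : mu_gen (m + m') (n + n') :=
  MuGen (fun i => sum_ops (split i)) (fun i => sum_lab (z := split i)) gtens_lab_bij.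
End GenTensor.

(* is_mu_monad M and is_Cat S say that M is the monad mu O and that S is the PROP
   Cat O: the operations on generators are those induced by the operad. By
   bilinearity this determines all operations, see mu_monad_uniq and Cat_uniq. *)
Definition is_mu_monad (M : monad_on mu) : Prop :=
  (forall l m n (g : mu_gen l m) (h : mu_gen m n),
     mcomp M (mu_cls g) (mu_cls h) = mu_cls (gcomp g h)) /\
  (forall n, mid M n = mu_cls (gid n)).

Definition is_Cat (S : prop_on mu) : Prop :=
  [/\ is_mu_monad S,
      forall m n m' n' (g : mu_gen m n) (h : mu_gen m' n'),
        ptens S (mu_cls g) (mu_cls h) = mu_cls (gtens g h) &
      forall m n, psym S m n = mu_cls (gsym m n)].

Lemma mu_ext m n (V : lmodType R) (f g : mu m n -> V) :
  linear f -> linear g -> (forall x, f (mu_cls x) = g (mu_cls x)) -> f =1 g.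
Proof.
move=> lf lg fg x; have [u ->] := qclsP x; move: u.
by apply: lin_ext => // a u v; rewrite linearP ?lf ?lg.
Qed.

(* Every generator is of the form x_1 (x) ... (x) x_m (x) s. *)
Lemma mu_genP m n (g : mu_gen m n) :
  exists (nu : 'I_m -> nat) (x : forall i, ocar O (nu i))
    (s : 'S_(\sum_(i < m) nu i)) (e : (\sum_(i < m) nu i = n)%N),
    mu_cls g = castT (T := mu) erefl e (mu_tensor x s).
Proof.
case: g => nu x l bl.
have e : (\sum_(i < m) nu i = n)%N.
  by rewrite -tagnat.card (bij_eq_card bl) card_ord.
case: n / e in l bl *.
have p_inj : injective (fun c => l (tagnat.sig1 c) (tagnat.sig2 c)).
  exact: inj_comp (bij_inj bl) (bij_inj tagnat.sig_bij).
exists nu, x, (perm p_inj)^-1%g, erefl.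
rewrite castT_id /mu_tensor; congr mu_cls.
have gen_eq l' bl' : l = l' -> MuGen x l bl = MuGen x l' bl'.
  by move=> el; subst l'; congr MuGen; apply: Prop_irrelevance.
apply: gen_eq; apply: functional_extensionality_dep => i.
apply: functional_extensionality_dep => j.
rewrite /block_lab invgK permE /tagnat.sig1 /tagnat.sig2 /tagnat.Rank.
by rewrite tagnat.rankK.
Qed.

Lemma mu_monad_uniq (M N : monad_on mu) : is_mu_monad M -> is_mu_monad N ->
  (forall l m n (u : mu l m) (v : mu m n), mcomp M u v = mcomp N u v) /\
  (forall n, mid M n = mid N n).
Proof.
move=> [cM iM] [cN iN]; split=> [l m n u v|n]; last by rewrite iM iN.
move: u; apply: mu_ext => [||g]; [exact: mcomp_linl | exact: mcomp_linl |].
move: v; apply: mu_ext => [||h]; [exact: mcomp_linr | exact: mcomp_linr |].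
by rewrite cM cN.
Qed.

Lemma Cat_uniq (S S' : prop_on mu) : is_Cat S -> is_Cat S' ->
  (forall m n m' n' (u : mu m n) (v : mu m' n'), ptens S u v = ptens S' u v) /\
  (forall m n, psym S m n = psym S' m n).
Proof.
move=> [_ tS sS] [_ tS' sS']; split=> [m n m' n' u v|m n]; last by rewrite sS sS'.
move: u; apply: mu_ext => [||g]; [exact: ptens_linl | exact: ptens_linl |].
move: v; apply: mu_ext => [||h]; [exact: ptens_linr | exact: ptens_linr |].
by rewrite tS tS'.
Qed.
End Mu.

Section Morphisms.
Variables (R : nzRingType) (T T' : nat -> nat -> lmodType R).

Definition monad_map (M : monad_on T) (M' : monad_on T')
    (F : forall m n, {linear T m n -> T' m n}) : Prop :=
  (forall l m n (u : T l m) (v : T m n),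
     F l n (mcomp M u v) = mcomp M' (F l m u) (F m n v)) /\
  (forall n, F n n (mid M n) = mid M' n).

Definition prop_map (P : prop_on T) (P' : prop_on T')
    (F : forall m n, {linear T m n -> T' m n}) : Prop :=
  [/\ monad_map P P' F,
      forall m n m' n' (u : T m n) (v : T m' n'),
        F _ _ (ptens P u v) = ptens P' (F m n u) (F m' n' v) &
      forall m n, F _ _ (psym P m n) = psym P' m n].
End Morphisms.

Definition inverse_maps (R : nzRingType) (T T' : nat -> nat -> lmodType R)
    (F : forall m n, {linear T m n -> T' m n})
    (G : forall m n, {linear T' m n -> T m n}) : Prop :=
  forall m n, cancel (F m n) (G m n) /\ cancel (G m n) (F m n).

Definition monad_iso (R : nzRingType) (T T' : nat -> nat -> lmodType R)
    (M : monad_on T) (M' : monad_on T')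
    (F : forall m n, {linear T m n -> T' m n}) : Prop :=
  monad_map M M' F /\
  exists G : forall m n, {linear T' m n -> T m n},
    monad_map M' M G /\ inverse_maps F G.

Definition prop_iso (R : nzRingType) (T T' : nat -> nat -> lmodType R)
    (P : prop_on T) (P' : prop_on T')
    (F : forall m n, {linear T m n -> T' m n}) : Prop :=
  prop_map P P' F /\
  exists G : forall m n, {linear T' m n -> T m n},
    prop_map P' P G /\ inverse_maps F G.

Definition is_natural (R : comNzRingType) (T : nat -> nat -> lmodType R) (P : prop_on T)
    (F : forall m n, {linear mu (operad_of P) m n -> T m n}) : Prop :=
  forall m (nu : 'I_m -> nat) (x : forall i, T 1%N (nu i))
      (s : 'S_(\sum_(i < m) nu i)),
    F m _ (mu_tensor (O := operad_of P) x s) = mcomp P (ptensn P x) (pperm P s).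

Definition operadic (R : comNzRingType) (T : nat -> nat -> lmodType R) (P : prop_on T) :
    Prop :=
  exists2 S : prop_on (mu (operad_of P)), is_Cat S &
  exists2 F : forall m n, {linear mu (operad_of P) m n -> T m n},
    is_natural F & prop_iso S P F.

Section EC.
Variables (R : comNzRingType) (C : lawvere) (Z : zero_object C).

Lemma eig_itens m (nu : 'I_m -> nat) (f : forall i, L R C 1 (nu i)) :
  (forall i, f i \in eig R Z 1 (nu i)) ->
  itens (T := L R C) << idm 0 >> (@ltens R C) f \in eig R Z m _.
Proof.
elim: m nu f => [|m IH] nu f Af /=; rewrite eig_cast; first exact: eig_id.
exact: (eig_tens (Af ord0) (IH _ _ (fun i => Af (lift ord0 i)))).
Qed.

(* The operad O_C; it is the underlying operad of the PROP Phi, see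
   operad_of_Phi. *)
Definition OC : operad_data R :=
  {| ocar := Phi R Z 1;
     oact n x s := phi_comp x (cls (eig_E R Z s));
     ounit := cls (eig_id R Z 1);
     ocomp m nu x y :=
       phi_comp x (itens (T := Phi R Z) (cls (eig_id R Z 0)) (@phi_tens R C Z) y) |}.

(* E_C([f_1] (x) ... (x) [f_m] (x) s) = [(f_1 x ... x f_m) o E_s]. By mu_genP, these
   elements span mu O_C. *)
Definition is_EC (E : forall m n, {linear mu OC m n -> Phi R Z m n}) : Prop :=
  forall m (nu : 'I_m -> nat) (f : forall i, L R C 1 (nu i))
      (Af : forall i, f i \in eig R Z 1 (nu i)) (s : 'S_(\sum_(i < m) nu i)),
    E m _ (mu_tensor (O := OC) (fun i => cls (Af i)) s)
    = cls (eig_comp (eig_itens Af) (eig_E R Z s)).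

Lemma pperm_Phi n (s : 'S_n) : pperm (Phi_prop R Z) s = cls (eig_E R Z s).
Proof.
elim: n s => [|n IH] s.
  by apply: cls_congr; congr << _ >>; apply: proj_ext; case.
rewrite [LHS]/= IH !phi_tensE castT_cls.
  by rewrite eig_cast eig_tens ?eig_swap ?eig_id.
move=> H; etransitivity; first exact: phi_compE.
apply: cls_congr.
have := Emor_lift C (perm_tail s) (cyc_src (s ord0)) (cyc_tgt (s ord0)).
rewrite perm_tailP => ->; rewrite ltensU castLU -lcompU; congr (lcomp _ _); exact: (@ltensU R C 1 1 n n (idm 1) (Emor C (perm_tail s))).
Qed.

Lemma operad_of_Phi : operad_of (Phi_prop R Z) = OC.
Proof.
rewrite /operad_of /OC; congr OperadData; apply: functional_extensionality_dep => n.
apply: functional_extensionality_dep => x; apply: functional_extensionality_dep => s.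
by rewrite pperm_Phi.
Qed.
End EC.

(* Main.v *)
(** Write [L(m,n) = k[C(n,m)]] and [Q = L / I^pr]. Modulo [I^pr] a morphism is
    additive in every variable, so [f = (f_1, ..., f_m)] splits as the sum over
    all maps [phi : {1..n} -> {1..m}] of the tensors of the [f_i] restricted to
    the variables in the fibre of [i], and this identifies [Q(m,n)] with the sum
    over [phi] of the tensor products of the [Q(1, phi^-1(i))]. Under it,
    [Phi(m,n)] consists of the tensors killed by the reduced diagonal in each
    factor. Over a field the subspace [O(n) = Phi(1,n)] of [L(1,n)] has a
    projection of the form [u - s (lD o u)] with [s] vanishing on [I^pr], and
    applying it in each factor gives the inverse of [E]. The monad and PROP
    structures on [mu O] are those of [Phi] transported along [E], so that only
    the values of [E] on generators have to be compared. *)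

From HB Require Import structures.
From mathcomp Require Import all_boot all_order all_fingroup all_algebra.
From mathcomp Require Import finmap boolp monalg generic_quotient.
From mathcomp Require classical_sets.
Require Import Defs.

Set Implicit Arguments.
Unset Strict Implicit.
Unset Printing Implicit Defensive.

Import GRing.Theory.
Local Open Scope quotient_scope.
Local Open Scope ring_scope.

(** * Multilinear maps and generalized inverses *)

(** The obstacle is that [Phi] is cut out by kernel conditions in all factors at once, and over a
    general ring the common kernel on a tensor product is not the tensor product of the kernels. The
    shape u - s (lD o u) of the projection is chosen against this: replacing u by its projection in
    one factor changes a tensor by s applied to the reduced diagonal of that factor. Summed over a
    whole element v, this change is the image of a reduced diagonal of v under a linear map that
    respects the ideal, so it vanishes when v lies in [eig]. Besides linearity, s only has to kill
    the ideal and invert the reduced diagonal in the generalized sense; no bases and no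
    compatibility between arities are needed. Tensor products of the quotients are never formed:
    maps out of [L] are given on morphisms and tested on the ideal, and maps out of [mu] are given
    on labelled generators and tested on the relations. *)

Section Linear.
Variables (R : nzRingType) (V V' : lmodType R) (f : V -> V').
Hypothesis lf : linear f.

Lemma linD u v : f (u + v) = f u + f v.
Proof. by have := lf 1 u v; rewrite !scale1r. Qed.
Lemma linB u v : f (u - v) = f u - f v.
Proof. by rewrite addrC -scaleN1r lf scaleN1r addrC. Qed.
End Linear.

Lemma linear_comp (R : nzRingType) (U V W : lmodType R) (f : V -> W) (g : U -> V) :
  linear f -> linear g -> linear (f \o g).
Proof. by move=> lf lg a u v /=; rewrite lg lf. Qed.

Section Submod.
Variables (R : nzRingType) (V : lmodType R) (W : submod V).

Lemma submod0 : 0 \in W. Proof. exact: (sm_closed W).1. Qed.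
Lemma submodP a u v : u \in W -> v \in W -> a *: u + v \in W.
Proof. exact: (sm_closed W).2. Qed.
Lemma submodD u v : u \in W -> v \in W -> u + v \in W.
Proof. by rewrite -{2}[u]scale1r; apply: submodP. Qed.
Lemma submodN u : u \in W -> - u \in W.
Proof. by move=> Wu; rewrite -scaleN1r -[_ *: _]addr0; apply: submodP submod0. Qed.
Lemma submodB u v : u \in W -> v \in W -> u - v \in W.
Proof. by move=> Wu Wv; apply: submodD (submodN Wv). Qed.
Lemma submod_sum (I : Type) (r : seq I) (P : pred I) (F : I -> V) :
  (forall i, P i -> F i \in W) -> \sum_(i <- r | P i) F i \in W.
Proof.
by move=> FW; apply: (big_ind (fun x => x \in W)) => //; [apply: submod0 | apply: submodD].
Qed.
End Submod.

Lemma lin_span0 (R : nzRingType) (V V' : lmodType R) (S : V -> Prop) (f : V -> V') :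
  linear f -> (forall u, S u -> f u = 0) -> forall u, u \in span_sm S -> f u = 0.
Proof.
move=> lf fS u /spanP; elim=> [|a x v Sx _ IH]; first exact: lin0.
by rewrite lf fS // IH scaler0 addr0.
Qed.

Section QuotientLift.
Variables (R : nzRingType) (V V' : lmodType R) (W : submod V) (f : V -> V').
Hypothesis lf : linear f.
Hypothesis fW : forall v, v \in W -> f v = 0.

Definition qlift (x : qmod W) : V' := f (repr (x : Quotient.quot (sm_zmod W))).

Lemma qliftE v : qlift (qcls W v) = f v.
Proof.
apply/eqP; rewrite -subr_eq0 -(linB lf); apply/eqP/fW.
by apply/qcls_eq; rewrite {1}/qcls reprK.
Qed.

Lemma qlift_linear : linear qlift.
Proof.
move=> a x y; have [u ->] := qclsP x; have [v ->] := qclsP y.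
by rewrite -linearP !qliftE lf.
Qed.
End QuotientLift.

Section Multilinear.
Variables (R : nzRingType) (m : nat).

(** Phrased with three families agreeing outside [i], so that families built by other means need not
    be rewritten as updates of a given one. *)
Definition multilinear (W : 'I_m -> lmodType R) (V : lmodType R)
    (F : (forall i, W i) -> V) : Prop :=
  forall i a u v w, w i = a *: u i + v i ->
    (forall j, j != i -> u j = w j) -> (forall j, j != i -> v j = w j) ->
    F w = a *: F u + F v.

Variables (W : 'I_m -> lmodType R) (V : lmodType R) (F : (forall i, W i) -> V).
Hypothesis mF : multilinear F.

Lemma multilinear0 u i : u i = 0 -> F u = 0.
Proof.
move=> ui0; have := @mF i (-1) u u u; rewrite ui0 scaler0 addr0 scaleN1r addNr.
exact.
Qed.

Lemma multilinear_dfwith i u : linear (fun x : W i => F (dfwith u x)).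
Proof.
move=> a x y; apply: (mF (i := i)) => [|j|j]; rewrite ?dfwith_in // eq_sym => ij;
  by rewrite !dfwith_out.
Qed.

Lemma multilinear_comp (V' : lmodType R) (g : V -> V') :
  linear g -> multilinear (fun u => g (F u)).
Proof. by move=> lg i a u v w wi ui vi; rewrite (mF wi ui vi) lg. Qed.

Lemma multilinear_args (W' : 'I_m -> lmodType R) (g : forall i, W' i -> W i) :
  (forall i, linear (g i)) -> multilinear (fun u => F (fun i => g i (u i))).
Proof.
move=> lg i a u v w wi ui vi; apply: (mF (i := i)) => [|j ji|j ji].
- by rewrite wi lg.
- by rewrite ui.
- by rewrite vi.
Qed.

Lemma multilinearB i u v w : w i = u i - v i ->
    (forall j, j != i -> u j = w j) -> (forall j, j != i -> v j = w j) ->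
  F w = F u - F v.
Proof.
move=> wi ui vi; rewrite addrC -scaleN1r; apply: (mF (i := i)) => //.
by rewrite scaleN1r addrC.
Qed.
End Multilinear.

Lemma dfwith_id (I : eqType) (T : I -> Type) (f : forall i, T i) i : dfwith f (f i) = f.
Proof. by apply: functional_extensionality_dep => j; case: dfwithP. Qed.

Lemma multilinear_ext (R : comNzRingType) m (X : 'I_m -> choiceType) (V : lmodType R)
    (F G : (forall i, {malg R[X i]}) -> V) :
  multilinear F -> multilinear G ->
  (forall f : forall i, X i, F (fun i => << f i >>) = G (fun i => << f i >>)) -> F =1 G.
Proof.
move=> mF mG FG.
(* The list [s] holds the indices at which [u] may fail to be a basis element; linear extension
   removes them one at a time. *)
suff H (s : seq 'I_m) u : (forall i, i \notin s -> exists f, u i = << f >>) -> F u = G u.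
  by move=> u; apply: (H (enum 'I_m)) => i; rewrite mem_enum.
elim: s u => [|i s IH] u us.
  have us' i : {f : X i | u i = << f >>} by apply: cid; apply: us.
  have -> : u = fun i => << sval (us' i) >>.
    by apply: functional_extensionality_dep => i; case: (us' i).
  exact: FG.
rewrite -(dfwith_id u i).
apply: (lin_ext (f := fun x => F (dfwith u x)) (g := fun x => G (dfwith u x))).
- exact: (multilinear_dfwith mF).
- exact: (multilinear_dfwith mG).
move=> x; apply: IH => j js; case: dfwithP js => [_|j' ij js]; first by exists x.
by apply: us; rewrite inE negb_or eq_sym ij.
Qed.

(** * Complements of subspaces by Zorn's lemma *)

Section Complement.
Import classical_sets.
Local Open Scope classical_set_scope.
Variables (k : fieldType) (V : lmodType k).

Lemma complement (W : submod V) :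
  exists U : submod V, (forall x, x \in U -> x \in W -> x = 0) /\
    (forall x, exists u w, [/\ u \in U, w \in W & x = u + w]).
Proof.
pose P (A : set V) := (forall a u v, A u -> A v -> A (a *: u + v)) /\
  (forall x, A x -> x \in W -> x = 0).
have [|A [[Alin A0] Amax]] := @Zorn_bigcup V P.
  move=> F FP Ftot; split=> [a u v [X FX Xu] [Y FY Yv]|x [X FX Xx]]; last first.
    exact: (FP X FX).2.
  case: (Ftot X Y FX FY) => [XY|YX]; [exists Y => // | exists X => //].
    by apply: (FP Y FY).1 => //; apply: XY.
  by apply: (FP X FX).1 => //; apply: YX.
have [u0 Au0] : exists u, A u.
  apply: contrapT => nA; have noA u : ~ A u by move=> Au; apply: nA; exists u.
  apply: (Amax [set 0]); last first.
    by split=> [a u v /= -> ->|x /= -> //]; rewrite scaler0 addr0.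
  by split=> [|/(_ 0 erefl)]; [move=> u /noA | apply: noA].
have Az : A 0 by have := Alin (-1) _ _ Au0 Au0; rewrite scaleN1r addNr.
have U_closed : submod_closed [pred x | `[< A x >]].
  by split=> [|a u v /asboolP Au /asboolP Av]; apply/asboolP => //; apply: Alin.
exists (Submod U_closed); split=> [x /asboolP|x]; first exact: A0.
have [Ax|nAx] := pselect (A x).
  by exists x, 0; rewrite addr0; split=> //; [apply/asboolP | apply: submod0].
pose B : set V := [set y | exists c u, A u /\ y = c *: x + u].
have AB : A `<` B.
  split=> [u Au|BA]; first by exists 0, u; rewrite scale0r add0r.
  by apply: nAx; apply: BA; exists 1, 0; rewrite scale1r addr0.
have Blin a u v : B u -> B v -> B (a *: u + v).
  move=> [c [y [Ay ->]]] [d [z [Az' ->]]]; exists (a * c + d), (a *: y + z); split.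
    exact: Alin.
  by rewrite scalerDr scalerDl scalerA !addrA; congr (_ + _); rewrite addrAC.
(* By maximality the enlarged subspace meets [W]. A nonzero common element must involve [x], and
   dividing by its coefficient decomposes [x]. *)
have : exists y, [/\ B y, y \in W & y <> 0].
  apply: contrapT => nB; apply: (Amax B AB); split=> // y By Wy.
  by apply: contrapT => y0; apply: nB; exists y.
case=> y [[c [u [Au ->]]] Wy y0].
have c0 : c != 0.
  by apply/eqP => c0; apply: y0; move: Wy; rewrite c0 scale0r add0r; apply: A0.
exists (- (c^-1 *: u)), (c^-1 *: (c *: x + u)); split.
- apply/asboolP; rewrite -scaleNr -[_ *: _]addr0; exact: Alin.
- by rewrite -[_ *: _]addr0; apply: submodP => //; apply: submod0.
- by rewrite scalerDr scalerA mulVf // scale1r addrC addrK.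
Qed.
End Complement.

Section GeneralizedInverse.
Variables (k : fieldType) (V V' : lmodType k) (f : V -> V').
Hypothesis lf : linear f.

(** With [K] a complement of the kernel and [U] a complement of the image, [s w] is the only [v] in
    [K] with [w - f v] in [U]; this uniqueness gives linearity. *)
Lemma generalized_inverse : exists2 s : V' -> V, linear s & forall v, f (s (f v)) = f v.
Proof.
have ker_closed : submod_closed [pred v | f v == 0].
  split=> [|a u v /eqP fu /eqP fv]; first by rewrite inE (lin0 lf).
  by rewrite inE lf fu fv scaler0 addr0.
have im_closed : submod_closed [pred w | `[< exists v, w = f v >]].
  split=> [|a _ _ /asboolP[u ->] /asboolP[v ->]]; apply/asboolP.
    by exists 0; rewrite (lin0 lf).
  by exists (a *: u + v); rewrite lf.
have [K [K0 KV]] := complement (Submod ker_closed).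
have [U [U0 UV]] := complement (Submod im_closed).
have ex w : exists v, v \in K /\ w - f v \in U.
  have [u [_ [Uu /asboolP[v ->] ->]]] := UV w.
  have [v1 [v2 [Kv1 /eqP fv2 ->]]] := KV v.
  by exists v1; split=> //; rewrite linD // fv2 addr0 addrK.
pose s w := sval (cid (ex w)).
have sP w v : v \in K -> w - f v \in U -> s w = v.
  move=> Kv Uv; rewrite /s; case: cid => v' /= [Kv' Uv'].
  apply/eqP; rewrite -subr_eq0; apply/eqP/K0; first exact: submodB.
  rewrite inE linB //; apply/eqP/U0.
    by have := submodB Uv Uv'; rewrite opprB addrC addrA addrNK.
  by apply/asboolP; exists (v' - v); rewrite linB.
have sK w : s w \in K /\ w - f (s w) \in U by apply: (svalP (cid (ex w))).
exists s => [a u v|v].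
  have [[Ku Uu] [Kv Uv]] := (sK u, sK v).
  apply: sP; first exact: submodP.
  by have := submodP a Uu Uv; rewrite lf opprD addrACA scalerBr.
have [_ Uv] := sK (f v); apply/esym/eqP; rewrite -subr_eq0; apply/eqP/U0 => //.
by apply/asboolP; exists (v - s (f v)); rewrite linB.
Qed.
End GeneralizedInverse.

(** Invert [f] followed by the quotient by [W], then precompose the inverse with the quotient map;
    this makes it vanish on [W]. *)
Lemma generalized_inverse_mod (k : fieldType) (V V' : lmodType k) (W : submod V')
    (f : V -> V') : linear f ->
  exists s : V' -> V, [/\ linear s, forall w, w \in W -> s w = 0 &
    forall v, f (v - s (f v)) \in W].
Proof.
move=> lf; have [s ls sK] := generalized_inverse (linear_comp (@qcls_linear _ _ W) lf).
exists (s \o qcls W); split=> [|w Ww|v].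
- exact: (linear_comp ls (@qcls_linear _ _ W)).
- rewrite /= (_ : qcls W w = 0) ?(lin0 ls) //.
  by rewrite -(raddf0 (qcls W)); apply/qcls_eq; rewrite subr0.
- by rewrite /= (linB lf); apply/qcls_eq; apply: esym; apply: sK.
Qed.

Lemma multilinear_sub3 (R : nzRingType) m (W : 'I_m -> lmodType R) (V : lmodType R)
    (F : (forall i, W i) -> V) i x y z w : multilinear F ->
    w i = x i - y i - z i -> (forall j, j != i -> x j = w j) ->
    (forall j, j != i -> y j = w j) -> (forall j, j != i -> z j = w j) ->
  F w = F x - F y - F z.
Proof.
move=> mF wi xw yw zw; rewrite (multilinearB mF (u := dfwith w (x i - y i)) (v := z) (i := i)) //.
- congr (_ - _); apply: (multilinearB mF (i := i)); first by rewrite dfwith_in.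
    by move=> j ji; rewrite dfwith_out ?xw // eq_sym.
  by move=> j ji; rewrite dfwith_out ?yw // eq_sym.
- by rewrite dfwith_in.
- by move=> j ji; rewrite dfwith_out // eq_sym.
Qed.

Lemma split_lshift m n (i : 'I_m) : split (lshift n i) = inl i.
Proof. exact: (unsplitK (inl i)). Qed.
Lemma split_rshift m n (i : 'I_n) : split (rshift m i) = inr i.
Proof. exact: (unsplitK (inr i)). Qed.

(** * Additivity in each variable modulo the ideal *)

Section Substitutions.
Variables (C : lawvere) (Z : zero_object C).

Lemma comp_zmor l m n (f : hom C m n) : f \oc zmor Z l m = zmor Z l n.
Proof. by rewrite /zmor cmpA (zfrom_uniq (f \oc _)). Qed.
Lemma zmor_comp l m n (f : hom C l m) : zmor Z m n \oc f = zmor Z l n.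
Proof. by rewrite /zmor -cmpA (zto_uniq (_ \oc f)). Qed.

Lemma eq_tup m n (f g : 'I_n -> hom C m 1) : f =1 g -> tup f = tup g.
Proof. by move=> fg; apply: tupE => i; rewrite proj_tup fg. Qed.

Lemma proj_pairl l m n (f : hom C l m) (g : hom C l n) i :
  proj (lshift n i) \oc pairm f g = proj i \oc f.
Proof. by rewrite -proj_prl -cmpA prl_pair. Qed.
Lemma proj_pairr l m n (f : hom C l m) (g : hom C l n) i :
  proj (rshift m i) \oc pairm f g = proj i \oc g.
Proof. by rewrite -proj_prr -cmpA prr_pair. Qed.
Lemma proj_ord1 m (f : hom C m 1) (i : 'I_1) : proj i \oc f = f.
Proof. by rewrite proj1 cmp1f. Qed.

Definition ren m n (s : 'I_n -> 'I_m) : hom C m n := tup (fun i => proj (s i)).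

Lemma ren_comp l m n (s : 'I_m -> 'I_l) (t : 'I_n -> 'I_m) :
  ren t \oc ren s = ren (s \o t).
Proof. by apply: proj_ext => i; rewrite cmpA !proj_tup. Qed.

Definition mask n (b : pred 'I_n) : hom C n n :=
  tup (fun i => if b i then proj i else zmor Z n 1).

(* With x = (x_1, ..., x_n), these are the substitutions (x, x_k), (x, 0) and
   (x with x_k replaced by 0, x_k) of n + 1 variables. *)
Definition spl0 n (k : 'I_n) : hom C n (n + 1) := pairm (idm n) (proj k).
Definition spl1 n (k : 'I_n) : hom C n (n + 1) := pairm (idm n) (zmor Z n 1).
Definition spl2 n (k : 'I_n) : hom C n (n + 1) := pairm (mask (predC1 k)) (proj k).

Lemma prod_eta_l : proj ord0 \oc prodm (idm 1) (eta Z) = idm 1.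
Proof.
have := proj_prodm_l (idm 1) (eta Z) (ord0 : 'I_1).
rewrite cmpf1 proj_prl -(proj1 C ord0).
rewrite (_ : lshift 1 ord0 = ord0); last exact: val_inj.
by move=> ->; congr proj; apply: val_inj.
Qed.
Lemma prod_eta_r : proj ord_max \oc prodm (idm 1) (eta Z) = zmor Z 1 1.
Proof.
have := proj_prodm_r (idm 1) (eta Z) (ord0 : 'I_1).
by rewrite comp_zmor zmor_comp (_ : rshift 1 ord0 = ord_max) //; apply: val_inj.
Qed.
Lemma eta_prod_l : proj ord0 \oc prodm (eta Z) (idm 1) = zmor Z 1 1.
Proof.
have := proj_prodm_l (eta Z) (idm 1) (ord0 : 'I_1).
by rewrite comp_zmor zmor_comp (_ : lshift 1 ord0 = ord0) //; apply: val_inj.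
Qed.
Lemma eta_prod_r : proj ord_max \oc prodm (eta Z) (idm 1) = idm 1.
Proof.
have := proj_prodm_r (eta Z) (idm 1) (ord0 : 'I_1).
rewrite cmpf1 proj_prr -(proj1 C ord0).
rewrite (_ : rshift 1 ord0 = ord_max); last exact: val_inj.
by move=> ->; congr proj; apply: val_inj.
Qed.

(** [q] and [p] only permute variables: in [dbar] the second copy of the doubled variable follows
    the first, in the [spl] substitutions it stands last. Thus generators of the ideal and split
    differences are converted into each other by composing with [p] or [q]. *)
Lemma dbar_split_var a b (k := lshift b (rshift a ord0) : 'I_(a + 1 + b)) :
  exists (q : hom C (a + 1 + b + 1) (a + 2 + b)) (p : hom C (a + 2 + b) (a + 1 + b + 1)),
  [/\ p \oc q = idm _, 
      q \oc spl0 k = prodm (prodm (idm a) (diag C)) (idm b),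
      q \oc spl1 k = prodm (prodm (idm a) (prodm (idm 1) (eta Z))) (idm b) &
      q \oc spl2 k = prodm (prodm (idm a) (prodm (eta Z) (idm 1))) (idm b)].
Proof.
pose s (r : 'I_(a + 2 + b)) : 'I_(a + 1 + b + 1) := match split r with
  | inl r' => match split r' with
              | inl i => lshift 1 (lshift b (lshift 1 i))
              | inr e => if (e : nat) is 0%N then lshift 1 k else rshift _ ord0
              end
  | inr j => lshift 1 (rshift (a + 1) j)
  end.
pose t (c : 'I_(a + 1 + b + 1)) : 'I_(a + 2 + b) := match split c with
  | inl c' => match split c' with
              | inl c'' => match split c'' with
                           | inl i => lshift b (lshift 2 i)
                           | inr _ => lshift b (rshift a ord0)
                           end
              | inr j => rshift (a + 2) j
              end
  | inr _ => lshift b (rshift a ord_max)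
  end.
have sl i : s (lshift b (lshift 2 i)) = lshift 1 (lshift b (lshift 1 i)).
  by rewrite /s !split_lshift.
have sm e : s (lshift b (rshift a e)) = if (e : nat) is 0%N then lshift 1 k else rshift _ ord0.
  by rewrite /s split_lshift split_rshift.
have sr j : s (rshift (a + 2) j) = lshift 1 (rshift (a + 1) j).
  by rewrite /s split_rshift.
(* The three equations differ only in the morphism [w] inserted at [k], so only the coordinate [k]
   and the extra one need separate checks. *)
have middle (w : hom C 1 2) (g : hom C (a + 1 + b) (a + 1 + b + 1)) :
    (forall i, i != k -> proj (lshift 1 i) \oc g = proj i) ->
    proj (lshift 1 k) \oc g = proj ord0 \oc w \oc proj k ->
    proj (rshift _ ord0) \oc g = proj ord_max \oc w \oc proj k ->
    ren s \oc g = prodm (prodm (idm a) w) (idm b).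
  move=> g_out g_k g_last; apply: proj_ext => r; rewrite cmpA proj_tup.
  case: (split_ordP r) => [r' ->|j ->]; last first.
    by rewrite sr proj_prodm_r !cmpf1 proj_prr g_out // eq_sym eq_lrshift.
  case: (split_ordP r') => [i ->|e ->].
    rewrite sl !proj_prodm_l !cmpf1 proj_prl proj_prl g_out //.
    by rewrite (inj_eq (@lshift_inj _ _)) eq_lrshift.
  have prk : prr C a 1 \oc prl C (a + 1) b = proj k.
    by rewrite -[LHS](proj_ord1 _ ord0) cmpA proj_prr proj_prl.
  rewrite sm proj_prodm_l proj_prodm_r -[RHS]cmpA prk.
  case: e => [[|[|//]] lt_e] /=; [rewrite g_k | rewrite g_last];
    by congr (proj _ \oc _ \oc _); apply: val_inj.
exists (ren s), (ren t); rewrite ren_comp; split.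
- apply: tupE => c; rewrite cmpf1; congr proj => /=; rewrite /t.
  case: split_ordP => [c' ->|j ->]; last by rewrite sm (ord1 j).
  case: split_ordP => [c'' ->|j ->]; last by rewrite sr.
  by case: split_ordP => [i ->|j ->]; [rewrite sl | rewrite sm (ord1 j)].
- by apply: middle => [i _||]; rewrite ?(proj_pairl, proj_pairr) ?cmpf1 ?proj_tup ?cmp1f ?proj_ord1.
- apply: middle => [i _||]; rewrite ?(proj_pairl, proj_pairr) ?cmpf1 //.
    by rewrite prod_eta_l cmp1f.
  by rewrite prod_eta_r comp_zmor zmor_comp.
- apply: middle => [i ik||]; rewrite ?(proj_pairl, proj_pairr).
  + by rewrite proj_tup /= ik.
  + by rewrite eta_prod_l proj_tup /= eqxx zmor_comp.
  + by rewrite eta_prod_r cmp1f proj_ord1.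
Qed.
End Substitutions.

Section Ideal.
Variables (R : comNzRingType) (C : lawvere) (Z : zero_object C).
Notation L := (L R C).
Notation I := (Ipr R Z).

(** The deviation of [F] from additivity in the variable [k]. Unlike [dbar], it needs no
    decomposition [a + 1 + b] of [n], hence no transport. *)
Definition spl n (k : 'I_n) m (F : hom C (n + 1) m) : L m n :=
  << F \oc spl0 C k >> - << F \oc spl1 Z k >> - << F \oc spl2 Z k >>.

Lemma lcompBr l m n (u : L l m) (v w : L m n) : lcomp u (v - w) = lcomp u v - lcomp u w.
Proof. exact: (linB (lcomp_linr u)). Qed.
Lemma lcompBl l m n (u : L m n) (v w : L l m) : lcomp (v - w) u = lcomp v u - lcomp w u.
Proof. exact: (linB (lcomp_linl u)). Qed.

Lemma ord_mid n (k : 'I_n) : exists a b (e : (a + 1 + b = n)%N),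
  k = cast_ord e (lshift b (rshift a ord0)).
Proof.
exists k, (n - k.+1)%N; have e : (k + 1 + (n - k.+1) = n)%N by rewrite addn1 subnKC.
by exists e; apply: val_inj; rewrite /= addn0.
Qed.

Lemma spl_mem n (k : 'I_n) m (F : hom C (n + 1) m) : spl k F \in I m n.
Proof.
have [a [b [e ek]]] := ord_mid k.
case: n / e k F ek => k F; rewrite cast_ord_id => ->.
have [q [p [pq q0 q1 q2]]] := dbar_split_var Z a b.
have -> : spl (lshift b (rshift a ord0)) F = lcomp << F \oc p >> (dbar R Z a b).
  rewrite /dbar !lcompBr !lcompU -q0 -q1 -q2.
  by rewrite !cmpA -![F \oc p \oc q]cmpA pq cmpf1.
exact: (mem_span (IprGen _ _)).
Qed.

(** For a morphism [f], the generator [f o dbar] is the split difference of [f o q]; linearity in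
    [f] does the rest. *)
Lemma Ipr_vanish m n (V : lmodType R) (g : L m n -> V) : linear g ->
  (forall (k : 'I_n) (F : hom C (n + 1) m), g (spl k F) = 0) ->
  forall u, u \in I m n -> g u = 0.
Proof.
move=> lg gspl; apply: Ipr_rect => [|a u v gu gv|a b e f]; first exact: lin0.
  by rewrite lg gu gv scaler0 addr0.
move: f; case: n / e g lg gspl => g lg gspl f; rewrite castT_id.
elim/malg_ind: f => [|c f u IH]; first by rewrite (lin0 (lcomp_linl _)) lin0.
rewrite lcomp_linl lg IH addr0.
have [q [p [pq q0 q1 q2]]] := dbar_split_var Z a b.
rewrite /dbar !lcompBr !lcompU -q0 -q1 -q2 !cmpA.
by rewrite -/(spl _ (f \oc q)) gspl scaler0.
Qed.

(* The split difference of f o prl is - (f o mask). *)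
Lemma mask_mem n (k : 'I_n) m (f : hom C n m) : << f \oc mask Z (predC1 k) >> \in I m n.
Proof.
have := spl_mem k (f \oc prl C n 1).
rewrite /spl -!cmpA !prl_pair cmpf1 subrr sub0r => /submodN.
by rewrite opprK.
Qed.
Lemma ignore_mem n (k : 'I_n) m (f : hom C n m) :
  f \oc mask Z (predC1 k) = f -> << f >> \in I m n.
Proof. by move=> <-; apply: mask_mem. Qed.
End Ideal.

Section ItensMultilinear.
Variables (R : nzRingType) (T : nat -> nat -> lmodType R) (e : T 0%N 0%N).
Variable t : forall m n m' n', T m n -> T m' n' -> T (m + m')%N (n + n')%N.
Hypothesis t_linl : forall m n m' n' (v : T m' n'), linear (fun u : T m n => t u v).
Hypothesis t_linr : forall m n m' n' (u : T m n), linear (fun v : T m' n' => t u v).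

Lemma castT_linear m m' n n' (em : m = m') (en : n = n') :
  linear (castT (T := T) em en : T m n -> T m' n').
Proof. by case: m' / em; case: n' / en. Qed.

Lemma itens_multilinear m (nu : 'I_m -> nat) :
  multilinear (fun u : forall i, T 1%N (nu i) => itens (T := T) e t u : T m _).
Proof.
elim: m nu => [|m' IH] nu' i a u v w wi ui vi; first by case: i {wi ui vi}.
move: ui vi wi; case: (unliftP ord0 i) => [j ->|->] ui vi wi /=.
  rewrite ui ?vi // (IH _ j a (fun i => u (lift ord0 i)) (fun i => v (lift ord0 i))) //.
  - by rewrite t_linr castT_linear.
  - by move=> j' j'j; rewrite ui // (inj_eq lift_inj).
  - by move=> j' j'j; rewrite vi // (inj_eq lift_inj).
have tail x : (forall j, j != ord0 -> x j = w j) ->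
    (fun j => x (lift ord0 j)) = fun j => w (lift ord0 j).
  by move=> xw; apply: functional_extensionality_dep => j; rewrite xw.
by rewrite wi t_linl castT_linear (tail u ui) (tail v vi).
Qed.
End ItensMultilinear.

(** * Tensors along a labelling of the variables *)

Section Labels.
Variables (R : comNzRingType) (C : lawvere) (Z : zero_object C).
Notation L := (L R C).
Notation I := (Ipr R Z).
Notation ltensn u := (itens (T := L) << idm 0 >> (@ltens R C) u).

(* Extension by zero: right inverse to the renaming along an injective l. *)
Definition inc p n (l : 'I_p -> 'I_n) : hom C p n :=
  tup (fun k => if [pick j | l j == k] is Some j then proj j else zmor Z p 1).

Section Inc.
Variables (p n : nat) (l : 'I_p -> 'I_n).

Lemma proj_inc j : injective l -> proj (l j) \oc inc l = proj j.
Proof.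
move=> l_inj; rewrite proj_tup; case: pickP => [j' /eqP/l_inj -> //|/(_ j)].
by rewrite eqxx.
Qed.
Lemma proj_inc0 k : (forall j, l j != k) -> proj k \oc inc l = zmor Z p 1.
Proof. by move=> lk; rewrite proj_tup; case: pickP => // j; rewrite (negPf (lk j)). Qed.

Lemma mask_inc (b : pred 'I_n) : injective l ->
  mask Z b \oc inc l = inc l \oc mask Z (b \o l).
Proof.
move=> l_inj; apply: proj_ext => k; rewrite !cmpA !proj_tup.
case: pickP => [j /eqP <-|lk].
  by rewrite proj_tup /=; case: (b _); rewrite ?zmor_comp ?proj_inc.
by rewrite zmor_comp; case: (b k); rewrite ?zmor_comp // proj_inc0 // => j; rewrite lk.
Qed.

Lemma inc_ren : inc l \oc ren C l = mask Z (fun k => [exists j, l j == k]).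
Proof.
apply: proj_ext => k; rewrite cmpA !proj_tup; case: pickP => [j /eqP <-|lk].
  by rewrite proj_tup (introT existsP) //; exists j.
by rewrite zmor_comp; case: existsP => // -[j]; rewrite lk.
Qed.
End Inc.

Section Tensor.
Variables (m : nat) (nu : 'I_m -> nat).

Lemma ltensn_multilinear : multilinear (fun u : forall i, L 1 (nu i) => ltensn u).
Proof.
by apply: itens_multilinear => *; [apply: ltens_linl | apply: ltens_linr].
Qed.

Lemma ltensn_mem u i : u i \in I 1 (nu i) -> ltensn u \in I m (\sum_i nu i).
Proof.
elim: m nu u i => [|m' IH] nu' u i ui; first by case: i {ui}.
rewrite /= Ipr_cast; move: ui; case: (unliftP ord0 i) => [j ->|->] ui.
  exact: (@Ipr_tensr R C Z 1 _ m' _ (u ord0) _ (IH _ (fun i => u (lift ord0 i)) j ui)).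
exact: (@Ipr_tensl R C Z 1 _ m' _ (u ord0) _ ui).
Qed.

Lemma proj0_prodm p q n (f : hom C p 1) (g : hom C q n) :
  proj ord0 \oc (prodm f g : hom C (p + q) n.+1) = f \oc prl C p q.
Proof.
have := proj_prodm_l f g ord0; rewrite proj_ord1 => <-.
by congr (proj _ \oc _); apply: val_inj.
Qed.
Lemma projS_prodm p q n (f : hom C p 1) (g : hom C q n) j :
  proj (lift ord0 j) \oc (prodm f g : hom C (p + q) n.+1) = proj j \oc g \oc prr C p q.
Proof. by rewrite -(proj_prodm_r f g); congr (proj _ \oc _); apply: val_inj. Qed.

Lemma ltensnU (f : forall i, hom C (nu i) 1) :
  ltensn (fun i => << f i >>) = << tup (fun i => f i \oc ren C (@tagnat.Rank m nu i)) >>.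
Proof.
elim: m nu f => [|m' IH] nu' f /=.
  by rewrite castLU; congr << _ >>; apply: proj_ext; case.
rewrite IH ltensU castLU; congr << _ >>; apply: proj_ext => i.
rewrite castmE cast_ord_id proj_tup.
case: (unliftP ord0 i) => [j ->|->].
  rewrite projS_prodm proj_tup -cmpA cast_compr; congr (_ \oc _).
  apply: proj_ext => c; rewrite castmE cast_ord_id cmpA !proj_tup cast_proj.
  congr proj; apply: val_inj.
  change (nu' ord0 + @tagnat.Rank m' (fun j => nu' (lift ord0 j)) j c =
          @tagnat.Rank _ nu' (lift ord0 j) c :> nat)%N.
  rewrite !tagnat.RankEsum addnA [in RHS]big_mkcond big_ord_recl /=.
  by rewrite [in LHS]big_mkcond.
rewrite proj0_prodm cast_compr; congr (_ \oc _).
apply: proj_ext => c; rewrite castmE cast_ord_id !proj_tup cast_proj.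
congr proj; apply: val_inj.
change (c = @tagnat.Rank _ nu' ord0 c :> nat).
by rewrite tagnat.RankEsum big1.
Qed.
End Tensor.

Lemma ren_Emor n (s : 'S_n) : ren C s = Emor C s^-1.
Proof. by apply: eq_tup => i; rewrite invgK. Qed.

(** A bijection forces [p = n], and the renaming becomes a permutation morphism. Keeping [p] and [n]
    apart spares casts for [block_ren]. *)
Lemma eig_ren p n (s : 'I_p -> 'I_n) : bijective s -> << ren C s >> \in eig R Z p n.
Proof.
move=> s_bij; have e : p = n by rewrite -[p]card_ord -[n]card_ord (bij_eq_card s_bij).
case: n / e s s_bij => s s_bij.
have := eig_E R Z (perm (bij_inj s_bij))^-1.
by rewrite -ren_Emor (_ : ren C _ = ren C s) //; apply: eq_tup => i; rewrite permE.
Qed.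

Section Theta.
Variables (m n : nat) (nu : 'I_m -> nat) (l : forall i, 'I_(nu i) -> 'I_n).
Arguments l : clear implicits.

Definition block_ren : hom C n (\sum_(i < m) nu i) :=
  ren C (fun c => l _ (tagnat.sig2 c)).
(** Factor [i] reads the variables [l i]. Being defined on [L] and not on classes, it accepts
    factors outside [eig], as [Tphi] requires. *)
Definition Theta (u : forall i, L 1 (nu i)) : L m n := lcomp (ltensn u) << block_ren >>.

Lemma Theta_multilinear : multilinear Theta.
Proof. exact: (multilinear_comp (@ltensn_multilinear m nu) (lcomp_linl << block_ren >>)). Qed.

Lemma ThetaU (f : forall i, hom C (nu i) 1) :
  Theta (fun i => << f i >>) = << tup (fun i => f i \oc ren C (l i)) >>.
Proof.
rewrite /Theta ltensnU lcompU; congr << _ >>; apply: proj_ext => i.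
rewrite cmpA !proj_tup -cmpA ren_comp; congr (_ \oc _); apply: eq_tup => j /=.
by rewrite /tagnat.sig1 /tagnat.sig2 /tagnat.Rank tagnat.rankK.
Qed.

Hypothesis l_bij : bijective (fun p : {i & 'I_(nu i)} => l _ (tagged p)).

Lemma lab_inj i : injective (l i).
Proof.
move=> j j' e; have := bij_inj l_bij (x1 := Tagged _ j) (x2 := Tagged _ j') e.
by move/eqP; rewrite eq_Tagged => /eqP.
Qed.
Lemma lab_disj i i' j j' : l i j = l i' j' -> i = i'.
Proof.
by move=> e; have /(congr1 tag) :=
  bij_inj l_bij (x1 := Tagged (fun i => 'I_(nu i)) j) (x2 := Tagged _ j') e.
Qed.

Lemma block_ren_eig : << block_ren >> \in eig R Z _ n.
Proof.
by apply: eig_ren; apply: bij_comp l_bij _; exists tagnat.rank;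
  [apply: tagnat.sigK | apply: tagnat.rankK].
Qed.

Lemma Theta_mem u i : u i \in I 1 (nu i) -> Theta u \in I m n.
Proof. by move=> ui; apply: Ipr_comp block_ren_eig; apply: ltensn_mem ui. Qed.

Lemma Theta_eig u : (forall i, u i \in eig R Z 1 (nu i)) -> Theta u \in eig R Z m n.
Proof. by move=> ue; apply: eig_comp block_ren_eig; apply: eig_itens. Qed.

(* Only the factor whose label is the split variable changes, so a split
   difference becomes a tensor with a split difference as one factor. *)
Lemma Ipr_multilinear M (V : lmodType R) (F : (forall i, L M (nu i)) -> V) :
  multilinear F -> (forall i u, u i \in I M (nu i) -> F u = 0) ->
  forall v, v \in I M n -> flin (fun f : hom C n M => F (fun i => << f \oc inc (l i) >>)) v = 0.
Proof.
move=> mF F0; pose g := flin (fun f : hom C n M => F (fun i => << f \oc inc (l i) >>)).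
have lg : linear g by move=> a u v; apply: linearP.
rewrite -/g; apply: (Ipr_vanish lg) => k G; have [[i j] /= <-] := bij_surj l_bij k.
rewrite (linB lg) (linB lg) /g !flinU.
pose x := fun i' => << G \oc spl0 C (l i j) \oc inc (l i') >> : L M (nu i').
pose y := fun i' => << G \oc spl1 Z (l i j) \oc inc (l i') >> : L M (nu i').
pose z := fun i' => << G \oc spl2 Z (l i j) \oc inc (l i') >> : L M (nu i').
have other i' : i' != i -> forall j', l i' j' != l i j.
  by move=> i'i j'; apply: contraNneq i'i => /lab_disj ->.
have xy i' : i' != i -> x i' = y i'.
  move=> i'i; rewrite /x /y -!cmpA !pair_comp; congr << G \oc pairm _ _ >>.
  by rewrite zmor_comp proj_inc0 //; apply: other.
have xz i' : i' != i -> x i' = z i'.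
  move=> i'i; have maskE : mask Z (predC1 (l i j)) \oc inc (l i') = inc (l i').
    rewrite mask_inc; last exact: lab_inj.
    rewrite -[RHS]cmpf1; congr (_ \oc _); apply: tupE => j'.
    by rewrite /= cmpf1 other.
  by rewrite /x /z -!cmpA !pair_comp maskE cmp1f.
(* The three families agree outside [i], so multilinearity gathers them into one family whose factor
   [i] is the difference. *)
rewrite -(multilinear_sub3 (i := i) (w := dfwith x (x i - y i - z i)) mF) ?dfwith_in //.
- apply: (F0 i); rewrite dfwith_in.
  (* Restricting [G] to the variables of factor [i] while keeping the extra variable turns this
     factor into a split difference in [j]. *)
  rewrite (_ : _ - _ = spl R Z j (G \oc prodm (inc (l i)) (idm 1))) ?spl_mem //.
  have l_inj := lab_inj (i := i).
  have maskE : mask Z (predC1 (l i j)) \oc inc (l i) = inc (l i) \oc mask Z (predC1 j).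
    rewrite mask_inc //; congr (_ \oc _); apply: eq_tup => j' /=.
    by rewrite (inj_eq l_inj).
  rewrite /spl /x /y /z -!cmpA !prodm_pair !pair_comp !cmp1f cmpf1.
  by rewrite (proj_inc _ l_inj) zmor_comp maskE.
- by move=> i' i'i; rewrite dfwith_out // eq_sym.
- by move=> i' i'i; rewrite dfwith_out ?xy // eq_sym.
- by move=> i' i'i; rewrite dfwith_out ?xz // eq_sym.
Qed.
End Theta.
End Labels.

(** * Expansion of a morphism over maps from variables to components *)

Section Splitting.
Variables (R : comNzRingType) (C : lawvere) (Z : zero_object C).
Notation L := (L R C).
Notation I := (Ipr R Z).
Variables (m n : nat) (f : 'I_m -> hom C n 1).

(* X k is the set of the components of f that keep the variable k. *)
Definition fmask (X : 'I_n -> {set 'I_m}) : hom C n m :=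
  tup (fun i => f i \oc mask Z (fun k => i \in X k)).

Lemma fmask_ext X Y : X =1 Y -> fmask X = fmask Y.
Proof.
move=> XY; apply: eq_tup => i; congr (_ \oc _); apply: eq_tup => k.
by rewrite XY.
Qed.

Lemma fmask_split k (X X1 X2 : 'I_n -> {set 'I_m}) :
  (forall k', k' != k -> X1 k' = X k') -> (forall k', k' != k -> X2 k' = X k') ->
  X k = X1 k :|: X2 k -> [disjoint X1 k & X2 k] ->
  << fmask X >> - << fmask X1 >> - << fmask X2 >> \in I m n.
Proof.
move=> X1E X2E Xk dis.
(* In slot [k], components in [X1 k] read the old variable and those in [X2 k] read the extra one.
   The three substitutions then keep both sets, only [X1 k], and only [X2 k]. *)
pose col i k' : hom C (n + 1) 1 :=
  if k' == k then
    if i \in X1 k then proj (lshift 1 k) else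
    if i \in X2 k then proj (rshift n ord0) else zmor Z (n + 1) 1
  else if i \in X k' then proj (lshift 1 k') else zmor Z (n + 1) 1.
pose G : hom C (n + 1) m := tup (fun i => f i \oc tup (col i)).
have := spl_mem R Z k G; rewrite /spl.
have GE g (Y : 'I_n -> {set 'I_m}) :
    (forall i k', (if i \in Y k' then proj k' else zmor Z n 1) = col i k' \oc g) ->
    G \oc g = fmask Y.
  move=> gY; rewrite tup_comp; apply: eq_tup => i; rewrite -cmpA; congr (_ \oc _).
  by rewrite tup_comp; apply: eq_tup => k'; rewrite gY.
have -> : G \oc spl0 C k = fmask X.
  apply: GE => i k'; rewrite /col; case: eqP => [->|_]; last first.
    by case: ifP; rewrite ?zmor_comp // proj_pairl cmpf1.
  rewrite Xk inE; case: (i \in X1 k) => /=; first by rewrite proj_pairl cmpf1.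
  by case: ifP; rewrite ?zmor_comp // proj_pairr proj_ord1.
have -> : G \oc spl1 Z k = fmask X1.
  apply: GE => i k'; rewrite /col; case: eqP => [->|/eqP k'k]; last first.
    by rewrite X1E //; case: ifP; rewrite ?zmor_comp // proj_pairl cmpf1.
  case: ifP => iX1; first by rewrite proj_pairl cmpf1.
  by case: ifP; rewrite ?zmor_comp // proj_pairr proj_ord1.
have -> // : G \oc spl2 Z k = fmask X2.
  apply: GE => i k'; rewrite /col; case: eqP => [->|/eqP k'k]; last first.
    by rewrite X2E //; case: ifP; rewrite ?zmor_comp // proj_pairl proj_tup /= k'k.
  case: (boolP (i \in X1 k)) => iX1.
    by rewrite (disjointFr dis iX1) proj_pairl proj_tup /= eqxx.
  by case: ifP; rewrite ?zmor_comp // proj_pairr proj_ord1.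
Qed.

(** Induction on the total size of the sets: an empty [X k] leaves no [phi], all singletons leave
    exactly one, and otherwise an element is split off some [X k], which partitions the maps [phi]
    by whether [phi k] is that element. *)
Lemma fmask_sum (X : 'I_n -> {set 'I_m}) :
  << fmask X >> - \sum_(phi : {ffun 'I_n -> 'I_m} | [forall k, phi k \in X k])
    << fmask (fun k => [set phi k]) >> \in I m n.
Proof.
have [N] := ubnP (\sum_k #|X k|); elim: N X => // N IH X XN.
have [/existsP[k /eqP Xk]|X0] := boolP [exists k, X k == set0].
  rewrite big_pred0 ?subr0 => [|phi]; last first.
    by apply/forallP => /(_ k); rewrite Xk inE.
  (* Since [X k] is empty, [X] splits into [X] and [X], which leaves minus [fmask X] in the
     ideal. *)
  have := fmask_split (k := k) (X := X) (fun _ _ => erefl) (fun _ _ => erefl).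
  rewrite Xk setU0 => /(_ erefl); rewrite subrr sub0r => /(_ _)/submodN.
  by rewrite opprK; apply; apply/pred0P => i; rewrite /= inE.
have [/existsP[k Xk]|X1] := boolP [exists k, 1 < #|X k|]%N; last first.
  have ex k : exists i, X k = [set i].
    apply/cards1P; rewrite eqn_leq leqNgt; move/existsPn: X1 => ->.
    by rewrite card_gt0; move/existsPn: X0 => ->.
  pose phi := [ffun k => sval (cid (ex k))].
  have XE k : X k = [set phi k] by rewrite ffunE; case: (cid _).
  rewrite (big_pred1 phi) => [|psi]; first by rewrite (fmask_ext XE) subrr submod0.
  apply/forallP/eqP => [H|-> k]; last by rewrite XE inE.
  by apply/ffunP => k; have := H k; rewrite XE inE => /eqP.
have [i Xi] : exists i, i \in X k by apply/card_gt0P; apply: ltnW.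
pose X1' k' := if k' == k then [set i] else X k'.
pose X2' k' := if k' == k then X k :\ i else X k'.
have lt_sum Y : (forall k', k' != k -> Y k' = X k') -> (#|Y k| < #|X k|)%N ->
    (\sum_k #|Y k| < N)%N.
  move=> YX lt; move: XN; rewrite ltnS; apply: leq_trans.
  rewrite (bigD1 k) // [X in (_ < X)%N](bigD1 k) //=.
  by rewrite (eq_bigr (fun k => #|X k|)) ?ltn_add2r // => k' /YX ->.
have X1E k' : k' != k -> X1' k' = X k' by rewrite /X1' => /negPf ->.
have X2E k' : k' != k -> X2' k' = X k' by rewrite /X2' => /negPf ->.
have X1k : X1' k = [set i] by rewrite /X1' eqxx.
have X2k : X2' k = X k :\ i by rewrite /X2' eqxx.
have I1 := IH X1' (lt_sum X1' X1E _); have I2 := IH X2' (lt_sum X2' X2E _).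
have {I1 I2} := submodD (I1 _) (I2 _).
rewrite X1k X2k cards1 Xk [#|X k|](cardsD1 i) Xi ltnSn => /(_ isT isT).
have := @fmask_split k X X1' X2' X1E X2E.
rewrite X1k X2k setD1K // -setI_eq0 setIDA setIC -setIDA setDv setI0 eqxx.
move=> /(_ erefl isT) I0 /(submodD I0).
have fam (Y : 'I_n -> {set 'I_m}) (P : pred 'I_m) :
    (forall k', k' != k -> Y k' = X k') -> Y k = [set j in X k | P j] ->
    forall phi : {ffun 'I_n -> 'I_m},
      [forall k', phi k' \in X k'] && P (phi k) = [forall k', phi k' \in Y k'].
  move=> YX Yk phi; apply/andP/forallP => [[/forallP phiX Pk] k'|phiY].
    by have [->|k'k] := eqVneq k' k; [rewrite Yk inE phiX Pk | rewrite YX].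
  have := phiY k; rewrite Yk inE => /andP[Xphik Pk]; split=> //; apply/forallP => k'.
  by have [->//|k'k] := eqVneq k' k; rewrite -YX.
have sumE (W : lmodType R) (F : {ffun 'I_n -> 'I_m} -> W) :
    \sum_(phi : {ffun 'I_n -> 'I_m} | [forall k', phi k' \in X k']) F phi =
    \sum_(phi : {ffun 'I_n -> 'I_m} | [forall k', phi k' \in X1' k']) F phi +
    \sum_(phi : {ffun 'I_n -> 'I_m} | [forall k', phi k' \in X2' k']) F phi.
  rewrite (bigID (fun phi : {ffun 'I_n -> 'I_m} => phi k == i)) /=.
  congr (_ + _); apply: eq_bigl => phi.
    apply: (fam X1' (pred1 i)) => //.
    by rewrite X1k; apply/setP => j; rewrite !inE andbC; case: eqP => // ->.
  by apply: (fam X2' (predC1 i)) => //; rewrite X2k; apply/setP => j; rewrite !inE andbC.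
rewrite (sumE (L m n)).
have alg (W : zmodType) (x y z u v : W) : x - y - z + ((y - u) + (z - v)) = x - (u + v).
  by rewrite -[x - y - z]addrA -opprD [y - u + _]addrACA -opprD addrA addrNK.
by rewrite alg.
Qed.
End Splitting.

Section Fibres.
Variables (m n : nat) (phi : {ffun 'I_n -> 'I_m}).

Definition fib i := [pred k | phi k == i].
Definition fib_lab i (j : 'I_#|fib i|) : 'I_n := enum_val j.

Lemma fib_labP i (j : 'I_#|fib i|) : phi (fib_lab j) = i.
Proof. by have := enum_valP j; rewrite inE => /eqP. Qed.

Lemma fib_lab_surj k : exists j, @fib_lab (phi k) j = k.
Proof.
have kf : k \in fib (phi k) by rewrite inE.
by exists (enum_rank_in kf k); rewrite /fib_lab enum_rankK_in.
Qed.

Lemma fib_lab_bij : bijective (fun p : {i & 'I_#|fib i|} => fib_lab (tagged p)).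
Proof.
apply: inj_surj_bij => [[i j] [i' j'] /= e|k].
  have ei : i = i' by rewrite -(fib_labP j) -(fib_labP j') e.
  by subst i'; move/enum_val_inj: e => ->.
by have [j jk] := fib_lab_surj k; exists (Tagged (fun i => 'I_#|fib i|) j).
Qed.
End Fibres.

(** * Projection onto the operations of the operad *)

Section Projection.
Variables (R : comNzRingType) (C : lawvere) (Z : zero_object C).
Notation L := (L R C).
Notation I := (Ipr R Z).
Notation eig := (eig R Z).
Notation Phi := (Phi R Z).

(** This is [fmask_sum] with nothing masked: letting component [i] keep only the fibre of [i]
    amounts to [inc] after [ren] for that fibre. *)
Lemma fibre_splitting m n (f : hom C n m) :
  << f >> - \sum_(phi : {ffun 'I_n -> 'I_m})
    Theta (@fib_lab m n phi) (fun i => << proj i \oc f \oc inc Z (@fib_lab m n phi i) >>)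
  \in I m n.
Proof.
have := fmask_sum R Z (fun i => proj i \oc f) (fun=> [set: 'I_m]).
rewrite (_ : fmask _ _ _ = f); last first.
  apply: tupE => i; rewrite -[LHS]cmpf1; congr (_ \oc _).
  by apply/esym/tupE => k; rewrite cmpf1 inE.
rewrite (eq_bigl predT) => [|phi]; last by apply/forallP => k; rewrite inE.
rewrite (eq_bigr (fun phi : {ffun 'I_n -> 'I_m} => Theta (@fib_lab m n phi)
  (fun i => << proj i \oc f \oc inc Z (@fib_lab m n phi i) >>))) // => phi _.
rewrite ThetaU; congr << _ >>; apply: eq_tup => i.
rewrite -[RHS]cmpA inc_ren; congr (_ \oc _); apply: eq_tup => k.
rewrite inE (_ : [exists _, _] = (i == phi k)) //.
apply/existsP/eqP => [[j /eqP <-]|->]; first by rewrite fib_labP.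
by have [j jk] := fib_lab_surj phi k; exists j; apply/eqP.
Qed.

Lemma dbar00 : dbar R Z 0 0 = lD R Z.
Proof.
rewrite dbarE ltens0l -[LHS](castT_id (T := L) (addn0 2) (addn0 1)).
exact: (ltens0r (lD R Z)).
Qed.

(** When [m = 1], [a + 1 + b = 1] leaves the single generator [dbar 0 0], so [eig] is the kernel of
    one linear map modulo the ideal. *)
Lemma eig1P n (u : L 1 n) : u \in eig 1 n <-> lcomp (lD R Z) u \in I 2 n.
Proof.
split=> [/eigP|Iu]; first by apply; rewrite -dbar00; exact: (@dbar_mem R C Z 0 0 1 erefl).
apply: eig_gen => a b e.
have /andP[/eqP a0 /eqP b0] : (a == 0%N) && (b == 0%N).
  by rewrite -addn_eq0 -eqSS -addSn -addn1 e.
subst a b; by rewrite (eq_irrelevance e erefl) dbar00.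
Qed.

Lemma Ipr_eig m n u : u \in I m n -> u \in eig m n.
Proof. by move=> Iu; apply/eigP => l h _; apply: Ipr_left. Qed.

Lemma cls_Ipr m n u (Au : u \in eig m n) : u \in I m n -> cls Au = 0 :> Phi m n.
Proof.
move=> Iu; have A0 : 0 \in eig m n := submod0 _.
rewrite -[RHS](_ : cls A0 = 0); first by apply/scls_eq; rewrite subr0.
by rewrite /cls /scls -(raddf0 (qcls _)); congr qcls; apply: val_inj; rewrite raddf0.
Qed.

(* A generalized inverse of u |-> lD o u modulo Ipr. Over a field it exists, and
   u - s (lD o u) is then a projection onto eig 1 n. *)
Variable s : forall n, L 2 n -> L 1 n.
Hypothesis s_lin : forall n, linear (@s n).
Hypothesis s_Ipr : forall n u, u \in I 2 n -> s u = 0.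
Hypothesis s_split : forall n (u : L 1 n),
  lcomp (lD R Z) (u - s (lcomp (lD R Z) u)) \in I 2 n.

Definition eproj n (u : L 1 n) : L 1 n := u - s (lcomp (lD R Z) u).

Lemma eproj_lin n : linear (@eproj n).
Proof.
by move=> a u v; rewrite /eproj lcomp_linr s_lin scalerBr opprD addrACA.
Qed.
Lemma eproj_eig n (u : L 1 n) : eproj u \in eig 1 n.
Proof. by apply/eig1P; apply: s_split. Qed.
Lemma eproj_id n (u : L 1 n) : u \in eig 1 n -> eproj u = u.
Proof. by move=> /eig1P Iu; rewrite /eproj s_Ipr ?subr0. Qed.

Definition cproj n (u : L 1 n) : Phi 1 n := cls (eproj_eig u).
Lemma cproj_lin n : linear (@cproj n).
Proof.
move=> a u v; rewrite /cproj.
have A : a *: eproj u + eproj v \in eig 1 n by apply: submodP; apply: eproj_eig.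
by rewrite -(scls_lin _ _ _ A); apply: cls_congr; rewrite eproj_lin.
Qed.
Lemma cprojE n (u : L 1 n) (Au : u \in eig 1 n) : cproj u = cls Au.
Proof. by apply: cls_congr; apply: eproj_id. Qed.
Lemma cproj_Ipr n (u : L 1 n) : u \in I 1 n -> cproj u = 0.
Proof. by move=> Iu; rewrite (cprojE (Ipr_eig Iu)) cls_Ipr. Qed.
End Projection.

(** * The map E and its inverse *)

Section MuGenerators.
Variables (R : comNzRingType) (O : operad_data R) (m n : nat).

Lemma mu_cls_eq (nu : 'I_m -> nat) (x x' : forall i, ocar O (nu i))
    (l l' : forall i, 'I_(nu i) -> 'I_n)
    (bl : bijective (fun p : {i & 'I_(nu i)} => l _ (tagged p)))
    (bl' : bijective (fun p : {i & 'I_(nu i)} => l' _ (tagged p))) :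
  (forall i, x i = x' i) -> (forall i j, l i j = l' i j) ->
  mu_cls (MuGen x bl) = mu_cls (MuGen x' bl').
Proof.
move=> xx' ll'; have e : l = l'.
  by apply: functional_extensionality_dep => i; apply: functional_extensionality_dep.
subst l'; rewrite (functional_extensionality_dep xx').
by congr (mu_cls (MuGen _ _)); apply: Prop_irrelevance.
Qed.

Lemma mu_cls_multilinear (nu : 'I_m -> nat) (l : forall i, 'I_(nu i) -> 'I_n)
    (bl : bijective (fun p : {i & 'I_(nu i)} => l _ (tagged p))) :
  multilinear (fun x : forall i, ocar O (nu i) => mu_cls (MuGen x bl)).
Proof.
move=> i a u v w wi ui vi.
have wE x : (forall j, j != i -> x j = w j) -> x = dfwith w (x i).
  move=> xw; apply: functional_extensionality_dep => j.
  by case: dfwithP => // j'; rewrite eq_sym => /xw.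
rewrite (wE w) // (wE u ui) (wE v vi) wi.
by rewrite /mu_cls -linearP; apply/qcls_eq/mem_span; apply: MuLin.
Qed.

Lemma mu_cls_act (nu : 'I_m -> nat) (x : forall i, ocar O (nu i))
    (t : forall i, 'S_(nu i)) (l : forall i, 'I_(nu i) -> 'I_n)
    (bl : bijective (fun p : {i & 'I_(nu i)} => l _ (tagged p)))
    (blt : bijective (fun p : {i & 'I_(nu i)} => l _ (t _ (tagged p)))) :
  mu_cls (@MuGen _ _ _ _ nu (fun i => oact (x i) (t i)) (fun i j => l i (t i j)) blt) =
  mu_cls (MuGen x bl).
Proof. by apply/qcls_eq/mem_span; apply: MuAct. Qed.
End MuGenerators.

Section Evaluation.
Variables (R : comNzRingType) (C : lawvere) (Z : zero_object C).
Notation L := (L R C).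
Notation I := (Ipr R Z).
Notation eig := (eig R Z).
Notation Phi := (Phi R Z).
Notation OC := (OC R Z).
Notation phi_tensn x := (itens (T := Phi) (cls (eig_id R Z 0)) (@phi_tens R C Z) x).

Lemma phi_tensn_cls m (nu : 'I_m -> nat) (f : forall i, L 1 (nu i))
    (Af : forall i, f i \in eig 1 (nu i)) :
  phi_tensn (fun i => cls (Af i)) = cls (eig_itens Af).
Proof.
elim: m nu f Af => [|m IH] nu f Af /=.
  rewrite castT_cls; first by rewrite eig_cast eig_id.
  by move=> H; apply: cls_congr.
rewrite IH phi_tensE castT_cls; first by
  rewrite eig_cast; exact: (@eig_tens R C Z 1 _ m _ _ _ (Af ord0) (eig_itens _)).
by move=> H; apply: cls_congr.
Qed.

Lemma phi_rep m (nu : 'I_m -> nat) (x : forall i, Phi 1 (nu i)) :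
  exists (f : forall i, L 1 (nu i)) (Af : forall i, f i \in eig 1 (nu i)),
    x = fun i => cls (Af i).
Proof.
exists (fun i => smod_val (srep (x i))), (fun i => smodP (srep (x i))).
by apply: functional_extensionality_dep => i; rewrite /cls srepK.
Qed.

(** [block_ren] plays the role of E_s but has source [n] and target the sum of the arities, so these
    numbers need not be identified by a cast. *)
Definition Egen m n (g : mu_gen OC m n) : Phi m n :=
  phi_comp (phi_tensn (ops g)) (cls (block_ren_eig R Z (lab_bij g))).

Lemma Egen_cls m n (nu : 'I_m -> nat) (f : forall i, L 1 (nu i))
    (Af : forall i, f i \in eig 1 (nu i)) (l : forall i, 'I_(nu i) -> 'I_n)
    (bl : bijective (fun p : {i & 'I_(nu i)} => l _ (tagged p))) :
  Egen (@MuGen _ OC _ _ _ (fun i => cls (Af i)) l bl) = cls (Theta_eig bl Af).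
Proof.
rewrite /Egen /= phi_tensn_cls; etransitivity; first exact: phi_compE.
exact: cls_congr.
Qed.

(** Moves renamings from the factors into the labelling; for permutations this is the balancing
    relation [MuAct]. *)
Lemma Theta_ren m n (nu nu' : 'I_m -> nat) (l : forall i, 'I_(nu i) -> 'I_n)
    (l' : forall i, 'I_(nu' i) -> 'I_n) (h : forall i, hom C (nu i) (nu' i))
    (u : forall i, L 1 (nu' i)) :
  (forall i, h i \oc ren C (@l i) = ren C (@l' i)) ->
  Theta l (fun i => lcomp (u i) << h i >>) = Theta l' u.
Proof.
move=> hl; move: u; apply: multilinear_ext => [||f].
- exact: (multilinear_args (@Theta_multilinear R C m n nu l) (fun i => lcomp_linl << h i >>)).
- exact: Theta_multilinear.
rewrite (_ : (fun i => lcomp _ _) = fun i => << f i \oc h i >>); last first.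
  by apply: functional_extensionality_dep => i; rewrite lcompU.
by rewrite !ThetaU; congr << _ >>; apply: eq_tup => i; rewrite -cmpA hl.
Qed.

Lemma Egen_multilinear m n (nu : 'I_m -> nat) (l : forall i, 'I_(nu i) -> 'I_n)
    (bl : bijective (fun p : {i & 'I_(nu i)} => l _ (tagged p))) :
  multilinear (fun x : forall i, Phi 1 (nu i) => Egen (@MuGen _ OC _ _ _ x l bl)).
Proof.
have mT : multilinear (fun x : forall i, Phi 1 (nu i) => phi_tensn x : Phi m _).
  by apply: itens_multilinear => *;
     [apply: (ptens_linl (Phi_prop R Z)) | apply: (ptens_linr (Phi_prop R Z))].
exact: (multilinear_comp mT (mcomp_linl (Phi_monad R Z) (cls (block_ren_eig R Z bl)))).
Qed.

Lemma Egen_act m n (nu : 'I_m -> nat) (x : forall i, Phi 1 (nu i))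
    (t : forall i, 'S_(nu i)) (l : forall i, 'I_(nu i) -> 'I_n)
    (bl : bijective (fun p : {i & 'I_(nu i)} => l _ (tagged p)))
    (blt : bijective (fun p : {i & 'I_(nu i)} => l _ (t _ (tagged p)))) :
  Egen (@MuGen _ OC _ _ nu (fun i => oact (o := OC) (x i) (t i)) (fun i j => l i (t i j)) blt) =
  Egen (@MuGen _ OC _ _ nu x l bl).
Proof.
have [f [Af ->]] := phi_rep x.
have -> : (fun i => oact (o := OC) (cls (Af i)) (t i)) =
    fun i => cls (eig_comp (Af i) (eig_E R Z (t i))).
  by apply: functional_extensionality_dep => i; apply: phi_compE.
rewrite !Egen_cls; apply: cls_congr; apply: Theta_ren => i.
by rewrite ren_comp; apply: eq_tup => j /=; rewrite permKV.
Qed.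

Definition Elin m n (u : {malg R[mu_gen OC m n]}) : Phi m n := flin (@Egen m n) u.

Lemma Elin_lin m n : linear (@Elin m n).
Proof. by move=> a u v; apply: linearP. Qed.

Lemma Elin_rel m n u : u \in span_sm (@mu_rel R OC m n) -> Elin u = 0.
Proof.
move: u; apply: (lin_span0 (@Elin_lin m n)) => _ [nu x l bl i a u v|nu x t l bl blt].
  rewrite (linB (@Elin_lin m n)) Elin_lin /Elin !flinU.
  apply/eqP; rewrite subr_eq0; apply/eqP.
  exact: (multilinear_dfwith (Egen_multilinear bl)).
rewrite (linB (@Elin_lin m n)) /Elin !flinU.
by apply/eqP; rewrite subr_eq0; apply/eqP; apply: Egen_act.
Qed.

Definition Emap m n : mu OC m n -> Phi m n := qlift (@Elin m n).

Lemma Emap_lin m n : linear (@Emap m n).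
Proof. exact: qlift_linear (@Elin_lin m n) (@Elin_rel m n). Qed.

Lemma Emap_cls m n (g : mu_gen OC m n) : Emap (mu_cls g) = Egen g.
Proof. by rewrite /Emap /mu_cls qliftE ?/Elin ?flinU //; [apply: Elin_lin | apply: Elin_rel]. Qed.
End Evaluation.

Lemma ord2P (e : 'I_2) : e = ord0 \/ e = ord_max.
Proof. by case: e => [[|[|//]] lt]; [left | right]; apply: val_inj. Qed.

(** * Construction of the inverse of E *)

Section Inverse.
Variables (R : comNzRingType) (C : lawvere) (Z : zero_object C).
Notation L := (L R C).
Notation I := (Ipr R Z).
Notation eig := (eig R Z).
Notation Phi := (Phi R Z).
Notation OC := (OC R Z).
Variable s : forall n, L 2 n -> L 1 n.
Hypothesis s_lin : forall n, linear (@s n).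
Hypothesis s_Ipr : forall n u, u \in I 2 n -> s u = 0.
Hypothesis s_split : forall n (u : L 1 n),
  lcomp (lD R Z) (u - s (lcomp (lD R Z) u)) \in I 2 n.
Notation cproj := (cproj s_split).
Notation eproj := (eproj Z s).

Section Component.
Variables (m n : nat) (phi : {ffun 'I_n -> 'I_m}).
Notation lab := (@fib_lab m n phi).

(** The projection is composed last so that the value depends linearly on [f o inc], the form to
    which [Ipr_multilinear] applies. *)
Definition coord (f : hom C n m) i : L 1 #|fib phi i| :=
  lcomp << proj i >> << f \oc inc Z (@lab i) >>.
(* The component at phi of the inverse of Emap. *)
Definition Gphi (f : hom C n m) : mu OC m n :=
  mu_cls (@MuGen _ OC m n _ (fun i => cproj (coord f i)) _ (fib_lab_bij phi)).

Lemma Gphi_Ipr v : v \in I m n -> flin Gphi v = 0.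
Proof.
apply: (Ipr_multilinear (fib_lab_bij phi) (F := fun u : forall i, L m #|fib phi i| =>
  mu_cls (@MuGen _ OC m n _ (fun i => cproj (lcomp << proj i >> (u i))) _ (fib_lab_bij phi)))).
  exact: (multilinear_args (@mu_cls_multilinear _ OC m n _ _ (fib_lab_bij phi))
    (fun i => linear_comp (@cproj_lin _ _ _ _ s_lin s_split _) (lcomp_linr << proj i >>))).
move=> i u ui; apply: (multilinear0 (mu_cls_multilinear (fib_lab_bij phi)) (i := i)).
by apply: cproj_Ipr => //; apply: Ipr_left.
Qed.

Lemma Gphi_Theta (nu : 'I_m -> nat) (l : forall i, 'I_(nu i) -> 'I_n)
    (u : forall i, L 1 (nu i)) :
  flin Gphi (Theta l u) = mu_cls (@MuGen _ OC m n _
    (fun i => cproj (lcomp (u i) << ren C (@l i) \oc inc Z (@lab i) >>)) _ (fib_lab_bij phi)).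
Proof.
move: u; apply: multilinear_ext => [||f].
- by apply: (multilinear_comp (@Theta_multilinear R C m n nu l)) => a u v; apply: linearP.
- exact: (multilinear_args (@mu_cls_multilinear _ OC m n _ _ (fib_lab_bij phi))
    (fun i => linear_comp (@cproj_lin _ _ _ _ s_lin s_split _) (lcomp_linl _))).
rewrite ThetaU flinU; apply: mu_cls_eq => // i.
by rewrite /coord !lcompU !cmpA proj_tup.
Qed.

(** Here [l i] and the enumeration of the fibre of [i] have the same image, so they differ by a
    permutation [t i], which [MuAct] absorbs. *)
Lemma Gphi_Theta_eq (nu : 'I_m -> nat) (l : forall i, 'I_(nu i) -> 'I_n)
    (bl : bijective (fun p : {i & 'I_(nu i)} => l _ (tagged p)))
    (u : forall i, L 1 (nu i)) (Au : forall i, u i \in eig 1 (nu i)) :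
  (forall i j, phi (l i j) = i) ->
  flin Gphi (Theta l u) = mu_cls (@MuGen _ OC _ _ _ (fun i => cls (Au i)) l bl).
Proof.
move=> phil; rewrite Gphi_Theta.
(* [l i] enumerates the fibre of [i]; substituting its size gives both labellings the same type. *)
have nuE : nu = fun i => #|fib phi i|.
  apply: functional_extensionality_dep => i.
  rewrite -[nu i]card_ord -(card_imset predT (lab_inj bl (i := i))) /=.
  apply: eq_card => k; rewrite inE; apply/imsetP/eqP => [[j _ ->]//|phik].
  have [[i' j] /= e] := bij_surj bl k.
  by move: phik; rewrite -e phil => ei; subst i'; exists j.
subst nu.
have ex i j : exists j', @lab i j' = l i j.
  by have := fib_lab_surj phi (l i j); rewrite phil.
pose tau i j := sval (cid (ex i j)).
have tauE i j : lab (tau i j) = l i j by rewrite /tau; case: cid.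
have tau_inj i : injective (tau i).
  by move=> j j' e; apply: (lab_inj bl); rewrite -!tauE e.
pose t i := ((perm (@tau_inj i))^-1)%g.
have lt i j : l i (t i j) = lab j.
  by rewrite -tauE -[tau i _](permE (@tau_inj i)) permKV.
have blt : bijective (fun p : {i & 'I_#|fib phi i|} => l _ (t _ (tagged p))).
  by apply: (eq_bij (fib_lab_bij phi)) => -[i j] /=; rewrite lt.
rewrite -(@mu_cls_act R OC m n _ (fun i => cls (Au i)) t l bl blt).
apply: mu_cls_eq => [i|i j]; last by rewrite lt.
have -> : ren C (l i) \oc inc Z (@lab i) = Emor C (t i).
  apply: proj_ext => j; rewrite cmpA [proj j \oc ren _ _]proj_tup [RHS]proj_tup invgK permE.
  rewrite -tauE proj_inc //.
  exact: enum_val_inj.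
rewrite (cprojE s_Ipr s_split (eig_comp (Au i) (eig_E R Z (t i)))).
exact/esym/phi_compE.
Qed.

(** The restriction of factor [phi k] to its fibre ignores the variable at the position of [k], so
    it lies in the ideal and [cproj] kills it. *)
Lemma Gphi_Theta_neq (nu : 'I_m -> nat) (l : forall i, 'I_(nu i) -> 'I_n)
    (u : forall i, L 1 (nu i)) k :
  (forall j, l (phi k) j != k) -> flin Gphi (Theta l u) = 0.
Proof.
move=> lk; rewrite Gphi_Theta.
apply: (multilinear0 (@mu_cls_multilinear _ OC m n _ _ (fib_lab_bij phi)) (i := phi k)).
apply: cproj_Ipr => //; apply: Ipr_left.
have [j0 j0k] := fib_lab_surj phi k.
apply: (ignore_mem R (k := j0)); rewrite -cmpA; apply: proj_ext => j.
rewrite !cmpA [proj j \oc ren _ _]proj_tup [proj (l _ _) \oc _]proj_tup.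
case: pickP => [j' /eqP j'l|_]; last by rewrite zmor_comp.
rewrite proj_tup /=; case: eqP => // j'0.
by case/eqP: (lk j); rewrite -j'l j'0 j0k.
Qed.

(* A records the factors to which the projection has been applied. *)
Definition Tphi (A : pred 'I_m) (f : hom C n m) : L m n :=
  Theta (fib_lab (phi := phi)) (fun i => if A i then eproj (coord f i) else coord f i).

End Component.

Section Total.
Variables (m n : nat).

Definition Glin (v : L m n) : mu OC m n :=
  \sum_(phi : {ffun 'I_n -> 'I_m}) flin (Gphi phi) v.

Lemma Glin_lin : linear Glin.
Proof.
move=> a u v; rewrite /Glin scaler_sumr -big_split; apply: eq_bigr => phi _.
exact: linearP.
Qed.

Lemma Glin_Ipr v : v \in I m n -> Glin v = 0.
Proof. by move=> Iv; apply: big1 => phi _; apply: Gphi_Ipr. Qed.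

(** Only the map [psi] read off from [l] contributes: any other [phi] sends some [k] to a factor
    that does not contain the label [k]. *)
Lemma Glin_Theta (nu : 'I_m -> nat) (l : forall i, 'I_(nu i) -> 'I_n)
    (bl : bijective (fun p : {i & 'I_(nu i)} => l _ (tagged p)))
    (u : forall i, L 1 (nu i)) (Au : forall i, u i \in eig 1 (nu i)) :
  Glin (Theta l u) = mu_cls (@MuGen _ OC _ _ _ (fun i => cls (Au i)) l bl).
Proof.
have [g lK gK] := bl.
pose psi := [ffun k => tag (g k)].
have psil i j : psi (l i j) = i by rewrite ffunE (lK (Tagged (fun i => 'I_(nu i)) j)).
rewrite /Glin (bigD1 psi) //= (Gphi_Theta_eq bl Au psil) big1 ?addr0 // => phi phipsi.
have [k /eqP phik] : exists k, phi k != psi k.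
  by apply/existsP; apply: contraNT phipsi => /existsPn H; apply/eqP/ffunP => k; apply/eqP/negPn/H.
apply: (@Gphi_Theta_neq m n phi nu l u k) => j; apply/eqP => lj.
by apply: phik; rewrite -{2}lj psil.
Qed.
End Total.

Definition Gmap m n (x : Phi m n) : mu OC m n :=
  qlift (fun v : smod (eig m n) => Glin (smod_val v)) x.

Lemma Gmap_cls m n (u : L m n) (Au : u \in eig m n) : Gmap (cls Au) = Glin u.
Proof.
rewrite /Gmap /cls /scls qliftE // => [a x y|[v Av]]; last exact: Glin_Ipr.
by rewrite -Glin_lin; congr Glin; apply: (linearP (val : smod (eig m n) -> L m n)).
Qed.

Lemma Gmap_lin m n : linear (@Gmap m n).
Proof.
move=> a x y; have [u [Au ->]] := clsP x; have [v [Av ->]] := clsP y.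
have Auv : a *: u + v \in eig m n by apply: submodP.
by rewrite -(scls_lin _ Au Av Auv) !Gmap_cls Glin_lin.
Qed.

Lemma EmapK m n : cancel (@Emap R C Z m n) (@Gmap m n).
Proof.
apply: mu_ext => [a x y|a x y|[nu x l bl]] //; first by rewrite Emap_lin Gmap_lin.
have [u [Au ->]] := phi_rep x.
by rewrite Emap_cls Egen_cls Gmap_cls (Glin_Theta bl Au).
Qed.
Section Surjectivity.
Variables (m n : nat).

(** Keeps a representative in [L] next to each element, so that sums over [phi] can be compared
    modulo the ideal. *)
Definition represents (x : mu OC m n) (u : L m n) : Prop :=
  exists Au : u \in eig m n, Emap x = cls Au.

Lemma represents0 : represents 0 0.
Proof.
exists (submod0 _); rewrite (lin0 (@Emap_lin _ _ _ _ _)) cls_Ipr //; exact: submod0.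
Qed.
Lemma representsD a x y u v :
  represents x u -> represents y v -> represents (a *: x + y) (a *: u + v).
Proof.
move=> [Au Eu] [Av Ev]; exists (submodP a Au Av).
by rewrite Emap_lin Eu Ev; apply/esym/scls_lin.
Qed.

Lemma Tphi_represents (phi : {ffun 'I_n -> 'I_m}) v :
  represents (flin (Gphi phi) v) (flin (Tphi phi predT) v).
Proof.
elim/malg_ind: v => [|a f u IH]; first by rewrite !raddf0; apply: represents0.
rewrite !flin_is_linear !flinU; apply: representsD IH.
pose Ac i := eproj_eig s_split (coord phi f i).
exists (Theta_eig (fib_lab_bij phi) Ac).
by rewrite Emap_cls; exact: (Egen_cls Ac (fib_lab_bij phi)).
Qed.

(* The factor i is compared through the lift of f to n -> m + 1 that doubles
   the i-th coordinate: its split difference lies in Ipr because v is in eig. *)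
Lemma Tphi_step (phi : {ffun 'I_n -> 'I_m}) (A B : pred 'I_m) i v :
  ~~ A i -> B =1 [predU1 i & A] -> v \in eig m n ->
  flin (Tphi phi A) v - flin (Tphi phi B) v \in I m n.
Proof.
move=> nAi BA Av.
(* [D] keeps coordinate [i] and its extra copy; after the three substitutions it gives the three
   terms of [lD] at coordinate [i]. *)
pose D : hom C (m + 1) 2 := tup (fun e =>
  if e == ord0 then proj (lshift 1 i) else proj (rshift m ord0)).
have D0 : D \oc spl0 C i = diag C \oc proj i.
  apply: proj_ext => e; rewrite !cmpA !proj_tup cmp1f.
  by case: eqP => _; rewrite ?proj_pairl ?cmpf1 // proj_pairr proj_ord1.
have D1 : D \oc spl1 Z i = (prodm (idm 1) (eta Z) : hom C 1 2) \oc proj i.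
  apply: proj_ext => e; rewrite !cmpA [proj e \oc D]proj_tup; case: (ord2P e) => -> /=.
    by rewrite prod_eta_l proj_pairl cmpf1 cmp1f.
  by rewrite prod_eta_r proj_pairr zmor_comp comp_zmor.
have D2 : D \oc spl2 Z i = (prodm (eta Z) (idm 1) : hom C 1 2) \oc proj i.
  apply: proj_ext => e; rewrite !cmpA [proj e \oc D]proj_tup; case: (ord2P e) => -> /=.
    by rewrite eta_prod_l proj_pairl proj_tup /= eqxx zmor_comp.
  by rewrite eta_prod_r proj_pairr proj_ord1 cmp1f.
pose sel j (b : bool) (x : L 1 #|fib phi j|) := if b then eproj x else x.
(* [s] is applied to the doubled coordinate in factor [i]; the other factors are treated as in
   [Tphi phi A]. *)
pose arg j (x : L (m + 1) #|fib phi j|) : L 1 #|fib phi j| :=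
  if j == i then s (lcomp << D >> x) else sel j (A j) (lcomp << proj (lshift 1 j) >> x).
have arg_lin j : linear (@arg j).
  rewrite /arg /sel; case: eqP => _; last case: (A j).
  - exact: (linear_comp (@s_lin _) (lcomp_linr << D >>)).
  - exact: (linear_comp (eproj_lin Z s_lin (n := _)) (lcomp_linr << proj (lshift 1 j) >>)).
  - exact: lcomp_linr.
have arg_Ipr j x : x \in I (m + 1) #|fib phi j| -> arg j x \in I 1 _.
  move=> Ix; rewrite /arg /sel; case: eqP => _.
    by rewrite s_Ipr ?submod0 //; apply: Ipr_left.
  have Iy : lcomp << proj (lshift 1 j) >> x \in I 1 _ by apply: Ipr_left.
  by case: (A j) => //; rewrite (eproj_id s_Ipr) // Ipr_eig.
pose F (u : forall j, L (m + 1) #|fib phi j|) : qmod (I m n) :=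
  qcls _ (Theta (fib_lab (phi := phi)) (fun j => arg j (u j))).
have mTh : multilinear (fun u => Theta (fib_lab (phi := phi)) (fun j => arg j (u j))).
  exact: (multilinear_args (@Theta_multilinear R C m n _ (fib_lab (phi := phi))) arg_lin).
have mF : multilinear F by apply: (multilinear_comp mTh (@qcls_linear _ _ (I m n))).
have F0 j u : u j \in I (m + 1) #|fib phi j| -> F u = 0.
  move=> Iu; rewrite -(raddf0 (qcls (I m n))); apply/qcls_eq; rewrite subr0.
  by apply: (Theta_mem (fib_lab_bij phi) (i := j)); apply: arg_Ipr.
pose Psi := flin (fun f : hom C n (m + 1) => F (fun j => << f \oc inc Z (@fib_lab m n phi j) >>)).
have Psi0 : Psi (lcomp (spl R Z i (idm (m + 1))) v) = 0.
  by apply: (Ipr_multilinear (fib_lab_bij phi) mF F0); apply: Ipr_comp Av; apply: spl_mem.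
have lT : linear (fun w => flin (Tphi phi A) w - flin (Tphi phi B) w).
  move=> a x y; have lA := flin_is_linear (Tphi phi A); have lB := flin_is_linear (Tphi phi B).
  by rewrite lA lB scalerBr opprD addrACA.
have PsiE w : Psi (lcomp (spl R Z i (idm (m + 1))) w) =
    qcls _ (flin (Tphi phi A) w - flin (Tphi phi B) w).
  have lP : linear Psi by move=> a x y; apply: linearP.
  move: w; apply: lin_ext => [a x y|a x y|f].
  - by rewrite lcomp_linr lP.
  - by rewrite lT qcls_linear.
  rewrite /spl !lcompBl !lcompU !cmp1f 2!(linB lP) /Psi !flinU /F -2!linearB.
  (* Both sides come from the tensor [w] with [s (lD o coord)] in factor [i], which is exactly what
     [eproj] subtracts there. *)
  pose a j := if A j then eproj (coord phi f j) else coord phi f j.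
  pose w := dfwith a (s (lcomp (lD R Z) (coord phi f i))).
  have wi : w i = s (lcomp (lD R Z) (coord phi f i)) by rewrite /w dfwith_in.
  have wj j : j != i -> w j = a j by rewrite eq_sym => ij; rewrite /w dfwith_out.
  have mT := @Theta_multilinear R C m n _ (fib_lab (phi := phi)).
  apply: (congr1 (qcls (I m n))); transitivity (Theta (fib_lab (phi := phi)) w).
    have argj g j : proj (lshift 1 j) \oc g = proj j -> j != i ->
        arg j << g \oc f \oc inc Z (@fib_lab m n phi j) >> = w j.
      move=> gj ji; rewrite wj // /arg (negPf ji) lcompU !cmpA gj.
      by rewrite /a /coord lcompU cmpA.
    apply/esym/(multilinear_sub3 (i := i) mT) => [|j ji|j ji|j ji].
    - rewrite wi /arg eqxx -2!(linB (@s_lin _)) !lcompU /coord lcompU /lD !lcompBl !lcompU.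
      by rewrite !cmpA D0 D1 D2.
    - by apply: argj => //; rewrite proj_pairl cmpf1.
    - by apply: argj => //; rewrite proj_pairl cmpf1.
    - by apply: argj => //; rewrite proj_pairl proj_tup /= ji.
  apply: (multilinearB (i := i) mT) => [|j ji|j ji].
  - by rewrite wi BA (negPf nAi) /= eqxx /eproj opprB addrC addrNK.
  - by rewrite wj.
  - by rewrite wj // BA /= (negPf ji).
by move: Psi0; rewrite PsiE -(raddf0 (qcls (I m n))) => /qcls_eq; rewrite subr0.
Qed.

(** Projections are switched on along a list of factors, and the successive differences
    telescope. *)
Lemma Tphi_all (phi : {ffun 'I_n -> 'I_m}) v : v \in eig m n ->
  flin (Tphi phi pred0) v - flin (Tphi phi predT) v \in I m n.
Proof.
move=> Av.
suff H (r : seq 'I_m) : forall A : pred 'I_m, A =1 mem r ->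
    flin (Tphi phi pred0) v - flin (Tphi phi A) v \in I m n.
  by apply: (H (enum 'I_m)) => i; rewrite /= mem_enum.
have extA (A B : pred 'I_m) : A =1 B -> flin (Tphi phi A) v = flin (Tphi phi B) v.
  by move=> AB; rewrite (functional_extensionality_dep AB).
elim: r => [|i r IH] A Ar; first by rewrite (extA A pred0) ?subrr ?submod0.
have [ir|ir] := boolP (i \in r).
  by apply: IH => j; rewrite Ar /= inE; case: eqP => // ->.
rewrite -(subrKA (flin (Tphi phi (mem r)) v)); apply: submodD; first exact: IH.
by apply: (@Tphi_step phi (mem r) A i v ir) => // j; rewrite Ar /= inE.
Qed.

Lemma Tphi_sum v :
  v - \sum_(phi : {ffun 'I_n -> 'I_m}) flin (Tphi phi pred0) v \in I m n.
Proof.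
elim/malg_ind: v => [|a f u IH].
  by rewrite big1 ?subr0 ?submod0 // => phi _; rewrite raddf0.
rewrite (eq_bigr (fun phi => a *: Tphi phi pred0 f + flin (Tphi phi pred0) u)); last first.
  by move=> phi _; rewrite flin_is_linear flinU.
rewrite big_split /= -scaler_sumr opprD addrACA -scalerBr; apply: submodP IH.
have := fibre_splitting R Z f.
rewrite (eq_bigr (fun phi : {ffun 'I_n -> 'I_m} => Tphi phi pred0 f)) // => phi _.
rewrite /Tphi /=; congr Theta; apply: functional_extensionality_dep => i.
by rewrite /coord lcompU cmpA.
Qed.

(** Modulo the ideal, [v] is its expansion without projections, hence the one with all projections
    because [v] is in [eig]; the latter represents the image of [Glin v]. *)
Lemma GmapK : cancel (@Gmap m n) (@Emap R C Z m n).
Proof.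
move=> x; have [v [Av ->]] := clsP x; rewrite Gmap_cls.
have [Aw ->] : represents (Glin v) (\sum_(phi : {ffun 'I_n -> 'I_m}) flin (Tphi phi predT) v).
  apply: (big_ind2 represents) => [|x1 u1 x2 u2 r1 r2|phi _].
  - exact: represents0.
  - by rewrite -[x1]scale1r -[u1]scale1r; apply: representsD.
  - exact: Tphi_represents.
apply/scls_eq; rewrite -[_ - v]opprB; apply: submodN.
rewrite -(subrKA (\sum_(phi : {ffun 'I_n -> 'I_m}) flin (Tphi phi pred0) v)).
apply: submodD; first exact: Tphi_sum.
by rewrite -sumrB; apply: submod_sum => phi _; apply: Tphi_all.
Qed.
End Surjectivity.
End Inverse.

(** * Compatibility with composition and tensor product *)

Section GeneratorOperations.
Variables (R : comNzRingType) (C : lawvere) (Z : zero_object C).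
Notation L := (L R C).
Notation eig := (eig R Z).
Notation Phi := (Phi R Z).
Notation OC := (OC R Z).
Notation ltensn u := (itens (T := L) << idm 0 >> (@ltens R C) u).

Lemma Egen_rep m n (g : mu_gen OC m n) (f : forall i, L 1 (ar g i))
    (Af : forall i, f i \in eig 1 (ar g i)) :
  (forall i, ops g i = cls (Af i)) -> Egen g = cls (Theta_eig (lab_bij g) Af).
Proof. 
case: g f Af => nu x l bl f Af /= xE.
by rewrite (functional_extensionality_dep xE); apply: Egen_cls.
 Qed.

Lemma Theta_gcomp l m n (g : mu_gen OC l m) (h : mu_gen OC m n)
    (u : forall i, L 1 (ar g i)) (w : forall j, L 1 (ar h j)) :
  Theta (gcomp_lab (g := g) (h := h)) (fun i => lcomp (u i) (ltensn (fun a => w (lab a))))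
  = lcomp (Theta (@lab _ _ _ _ g) u) (Theta (@lab _ _ _ _ h) w).
Proof.
move: u; apply: multilinear_ext => [||f].
- exact: (multilinear_args (@Theta_multilinear R C l n _ _)
    (fun i => lcomp_linl (ltensn (fun a => w (lab a))))).
- exact: (multilinear_comp (@Theta_multilinear R C l m _ _) (lcomp_linl _)).
move: w; apply: multilinear_ext => [||w].
(* The label [j] occurs exactly once in [g], as entry [a] of factor [i], so changing [w j] changes a
   single argument. *)
- move=> j c u v w wj uw vw; have [[i a] /= ia] := bij_surj (lab_bij g) j.
  apply: (@Theta_multilinear R C l n _ _ i) => [|i' i'i|i' i'i].
  + rewrite -lcomp_linr; apply: (congr1 (lcomp << f i >>)).
    apply: (@ltensn_multilinear R C _ _ a) => [|a' a'a|a' a'a].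
    * by rewrite ia.
    * by apply: uw; apply: contraNneq a'a; rewrite -ia => /(lab_inj (lab_bij g)) ->.
    * by apply: vw; apply: contraNneq a'a; rewrite -ia => /(lab_inj (lab_bij g)) ->.
  + have -> // : (fun a' : 'I_(ar g i') => u (lab a')) = fun a' => w (lab a').
    apply: functional_extensionality_dep => a'.
    by apply: uw; apply: contraNneq i'i; rewrite -ia => /(lab_disj (lab_bij g)) ->.
  + have -> // : (fun a' : 'I_(ar g i') => v (lab a')) = fun a' => w (lab a').
    apply: functional_extensionality_dep => a'.
    by apply: vw; apply: contraNneq i'i; rewrite -ia => /(lab_disj (lab_bij g)) ->.
- exact: (multilinear_comp (@Theta_multilinear R C m n _ _) (lcomp_linr _)).
rewrite !ThetaU lcompU.
rewrite (_ : (fun i => lcomp _ _) = fun i => << f i \oc tup (fun a : 'I_(ar g i) => w (lab a) \oc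
  ren C (@tagnat.Rank _ (fun a : 'I_(ar g i) => ar h (lab a)) a)) >>); last first.
  by apply: functional_extensionality_dep => i; rewrite ltensnU lcompU.
rewrite ThetaU tup_comp; apply: (congr1 (fun x => << x >>)); apply: eq_tup => i.
rewrite -!cmpA; congr (_ \oc _); rewrite tup_comp; apply: proj_ext => a.
rewrite proj_tup cmpA !proj_tup -cmpA ren_comp; congr (_ \oc _); apply: eq_tup => b /=.
by rewrite /gcomp_lab /tagnat.sig1 /tagnat.sig2 /tagnat.Rank tagnat.rankK.
Qed.

Lemma Egen_gcomp l m n (g : mu_gen OC l m) (h : mu_gen OC m n) :
  Egen (gcomp g h) = phi_comp (Egen g) (Egen h).
Proof.
have [u [Au gE]] := phi_rep (ops g); have [w [Aw hE]] := phi_rep (ops h).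
have gi i : ops g i = cls (Au i) by rewrite gE.
have hj j : ops h j = cls (Aw j) by rewrite hE.
pose A i := eig_comp (Au i) (eig_itens (fun a : 'I_(ar g i) => Aw (lab a))).
rewrite (Egen_rep gi) (Egen_rep hj) (@Egen_rep _ _ (gcomp g h) _ A) => [|i].
  by rewrite [RHS]phi_compE; apply: cls_congr; apply: Theta_gcomp.
rewrite /= gi.
have -> : (fun a : 'I_(ar g i) => ops h (lab a)) = fun a => cls (Aw (lab a)).
  by apply: functional_extensionality_dep => a.
by rewrite phi_tensn_cls; apply: phi_compE.
Qed.

Definition sum_fam m n m' n' (g : mu_gen OC m n) (h : mu_gen OC m' n')
    (u : forall i, L 1 (ar g i)) (w : forall i, L 1 (ar h i)) z : L 1 (sum_ar g h z) :=
  match z with inl a => u a | inr b => w b end.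

Lemma Theta_gtens m n m' n' (g : mu_gen OC m n) (h : mu_gen OC m' n')
    (u : forall i, L 1 (ar g i)) (w : forall i, L 1 (ar h i)) :
  Theta (@lab _ _ _ _ (gtens g h)) (fun i => sum_fam u w (split i))
  = ltens (Theta (@lab _ _ _ _ g) u) (Theta (@lab _ _ _ _ h) w).
Proof.
have split_neq i z : i != unsplit z -> @split m m' i <> z.
  by move=> iz e; case/eqP: iz; rewrite -e splitK.
move: u; apply: multilinear_ext => [||f].
- move=> i c u v x xi ux vx; apply: (@Theta_multilinear R C _ _ _ _ (lshift m' i)).
  (* Stated for a variable [z], since [split (lshift m' i)] cannot be rewritten inside the dependent
     types. *)
  + have H z : z = inl i -> sum_fam x w z = c *: sum_fam u w z + sum_fam v w z by move=> ->.
    exact: H (split_lshift _ _).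
  + have H z : z <> inl i -> sum_fam u w z = sum_fam x w z.
      by case: z => [a|b] //= zi; apply: ux; apply: contra_not_neq zi => ->.
    by move=> j /(split_neq _ (inl i)) /H.
  + have H z : z <> inl i -> sum_fam v w z = sum_fam x w z.
      by case: z => [a|b] //= zi; apply: vx; apply: contra_not_neq zi => ->.
    by move=> j /(split_neq _ (inl i)) /H.
- exact: (multilinear_comp (@Theta_multilinear R C _ _ _ _) (ltens_linl _)).
move: w; apply: multilinear_ext => [||f'].
- move=> i c u v x xi ux vx; apply: (@Theta_multilinear R C _ _ _ _ (rshift m i)).
  + have H z : z = inr i -> sum_fam (fun i => << f i >>) x z =
        c *: sum_fam (fun i => << f i >>) u z + sum_fam (fun i => << f i >>) v z by move=> ->.
    exact: H (split_rshift _ _).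
  + have H z : z <> inr i -> sum_fam (fun i => << f i >>) u z = sum_fam (fun i => << f i >>) x z.
      by case: z => [a|b] //= zi; apply: ux; apply: contra_not_neq zi => ->.
    by move=> j /(split_neq _ (inr i)) /H.
  + have H z : z <> inr i -> sum_fam (fun i => << f i >>) v z = sum_fam (fun i => << f i >>) x z.
      by case: z => [a|b] //= zi; apply: vx; apply: contra_not_neq zi => ->.
    by move=> j /(split_neq _ (inr i)) /H.
- exact: (multilinear_comp (@Theta_multilinear R C _ _ _ _) (ltens_linr _)).
pose hom_fam z : hom C (sum_ar g h z) 1 := match z with inl a => f a | inr b => f' b end.
rewrite (_ : (fun i => sum_fam _ _ (split i)) = fun i => << hom_fam (split i) >>); last first.
  by apply: functional_extensionality_dep => i; case: (split i).
rewrite !ThetaU ltensU; apply: (congr1 (fun x => << x >>)); apply: tupE => i.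
rewrite /= -[in LHS](splitK i); case: (split i) => j.
  rewrite proj_prodm_l proj_tup -!cmpA; congr (_ \oc _).
  by rewrite ren_comp.
rewrite proj_prodm_r proj_tup -!cmpA; congr (_ \oc _).
by rewrite ren_comp.
Qed.

Lemma Egen_gtens m n m' n' (g : mu_gen OC m n) (h : mu_gen OC m' n') :
  Egen (gtens g h) = phi_tens (Egen g) (Egen h).
Proof.
have [u [Au gE]] := phi_rep (ops g); have [w [Aw hE]] := phi_rep (ops h).
have gi i : ops g i = cls (Au i) by rewrite gE.
have hj j : ops h j = cls (Aw j) by rewrite hE.
have A z : sum_fam u w z \in eig 1 (sum_ar g h z) by case: z.
rewrite (Egen_rep gi) (Egen_rep hj) (@Egen_rep _ _ (gtens g h) _ (fun i => A (split i))) => [|i].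
  by rewrite [RHS]phi_tensE; apply: cls_congr; apply: Theta_gtens.
rewrite /=; case: (split i) => j /=; [rewrite gi | rewrite hj]; exact: cls_congr.
Qed.

(** Serves both units and symmetries, as [gid] and [gsym] differ only in the bijection. *)
Lemma Egen_gunit m n (f : 'I_m -> 'I_n) (f_bij : bijective f) (Af : << ren C f >> \in eig m n) :
  Egen (gunit OC f_bij) = cls Af.
Proof.
rewrite (@Egen_rep _ _ (gunit OC f_bij) (fun=> << idm 1 >>) (fun=> eig_id R Z 1)) //.
apply: cls_congr; rewrite ThetaU; apply: (congr1 (fun x => << x >>)); apply: eq_tup => i.
rewrite cmp1f; apply: proj_ext => j; rewrite proj_tup; exact/esym/proj_ord1.
Qed.
End GeneratorOperations.

(** * Transport of structure along E *)

Section Transport.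
Variables (R : nzRingType) (T T' : nat -> nat -> lmodType R).
Variables (F : forall m n, T m n -> T' m n) (G : forall m n, T' m n -> T m n).
Hypothesis F_lin : forall m n, linear (@F m n).
Hypothesis FK : forall m n, cancel (@F m n) (@G m n).
Hypothesis GK : forall m n, cancel (@G m n) (@F m n).

Lemma inv_lin m n : linear (@G m n).
Proof. by move=> a x y; apply: (can_inj (@FK m n)); rewrite F_lin !GK. Qed.

Lemma castT_map m m' n n' (em : m = m') (en : n = n') (x : T m n) :
  F (castT (T := T) em en x) = castT (T := T') em en (F x).
Proof. by case: m' / em; case: n' / en. Qed.

Definition Fmap m n : {linear T m n -> T' m n} :=
  HB.pack (@F m n) (GRing.isLinear.Build R (T m n) (T' m n) *:%R (@F m n) (@F_lin m n)).
Definition Finv m n : {linear T' m n -> T m n} :=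
  HB.pack (@G m n) (GRing.isLinear.Build R (T' m n) (T m n) *:%R (@G m n) (@inv_lin m n)).

Definition pull_monad (M : monad_on T') : monad_on T.
refine {| mcomp l m n u v := G (mcomp M (F u) (F v)); mid n := G (mid M n) |}.
- by move=> l m n v a x y; rewrite F_lin mcomp_linl inv_lin.
- by move=> l m n u a x y; rewrite F_lin mcomp_linr inv_lin.
- by move=> k l m n u v w; rewrite !GK mcompA.
- by move=> m n u; rewrite GK mcomp1l FK.
- by move=> m n u; rewrite GK mcomp1r FK.
Defined.

Definition pull_prop (P : prop_on T') : prop_on T.
refine {| pmonad := pull_monad P;
  ptens m n m' n' u v := G (ptens P (F u) (F v)); psym m n := G (psym P m n) |}.
- by move=> m n m' n' v a x y; rewrite F_lin ptens_linl inv_lin.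
- by move=> m n m' n' u a x y; rewrite F_lin ptens_linr inv_lin.
- by move=> l m n l' m' n' u v u' v' /=; rewrite !GK ptens_comp.
- by move=> m n /=; rewrite !GK ptens_id.
- move=> m n m' n' m'' n'' u v w /=; apply: (can_inj (@FK _ _)).
  by rewrite castT_map !GK ptensA.
- by move=> m n u /=; rewrite GK ptens0l FK.
- by move=> m n u /=; apply: (can_inj (@FK _ _)); rewrite castT_map !GK ptens0r.
- by move=> m n m' n' u v /=; rewrite !GK psym_nat.
- by move=> m n /=; rewrite !GK psymK.
- move=> m n p /=; apply: (can_inj (@FK _ _)).
  by rewrite castT_map castT_map !GK psym_hex.
Defined.

Lemma pull_monad_iso (M : monad_on T') : monad_iso (pull_monad M) M Fmap.
Proof.
split; first by split=> [l m n u v|n] /=; rewrite GK.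
exists Finv; split; last by move=> m n; split; [apply: FK | apply: GK].
by split=> [l m n u v|n] //=; rewrite !GK.
Qed.

Lemma pull_prop_iso (P : prop_on T') : prop_iso (pull_prop P) P Fmap.
Proof.
split; first by split=> [|m n m' n' u v|m n] /=; rewrite ?GK //; apply: (pull_monad_iso P).1.
exists Finv; split; last by move=> m n; split; [apply: FK | apply: GK].
by split=> [|m n m' n' u v|m n] //=; [split=> [l m n u v|n] //= |]; rewrite !GK.
Qed.
End Transport.

Section Main.
Variables (k : fieldType) (C : lawvere) (Z : zero_object C).
Notation L := (L k C).
Notation Phi := (Phi k Z).
Notation OC := (OC k Z).
Notation P := (Phi_prop k Z).
Notation E := (@Emap k C Z _ _).

Lemma Emap_bijective :
  exists G : forall m n, Phi m n -> mu OC m n,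
    (forall m n, cancel (@Emap k C Z m n) (@G m n)) /\
    (forall m n, cancel (@G m n) (@Emap k C Z m n)).
Proof.
(* This is where the field hypothesis enters; the inverses for different [n] are chosen
   independently. *)
pose ex n := cid (generalized_inverse_mod (Ipr k Z 2 n) (lcomp_linr (lD k Z) (n := n))).
pose s n := sval (ex n).
have s_lin n : linear (@s n) by have [] := svalP (ex n).
have s_Ipr n u : u \in Ipr k Z 2 n -> s n u = 0.
  by have [_ + _] := svalP (ex n); apply.
have s_split n u : lcomp (lD k Z) (u - s n (lcomp (lD k Z) u)) \in Ipr k Z 2 n.
  by have [_ _ +] := svalP (ex n); apply.
exists (@Gmap k C Z s s_split); split=> m n; [exact: EmapK | exact: GmapK].
Qed.

Lemma Emap_tensor m (nu : 'I_m -> nat) (f : forall i, L 1 (nu i))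
    (Af : forall i, f i \in eig k Z 1 (nu i)) (s : 'S_(\sum_(i < m) nu i)) :
  E (mu_tensor (O := OC) (fun i => cls (Af i)) s) = cls (eig_comp (eig_itens Af) (eig_E k Z s)).
Proof.
rewrite Emap_cls Egen_cls; apply: cls_congr; rewrite /Theta.
(* Both sides read the variable [s^-1 c] at rank [c]. *)
rewrite (_ : block_ren _ _ = Emor C s) //; apply: eq_tup => c.
by rewrite /block_lab tagnat.sig2K.
Qed.

Variable G : forall m n, Phi m n -> mu OC m n.
Hypothesis EK : forall m n, cancel (@Emap k C Z m n) (@G m n).
Hypothesis GK : forall m n, cancel (@G m n) (@Emap k C Z m n).
Notation S := (pull_prop (@Emap_lin k C Z) EK GK P).

Lemma pull_is_mu_monad : is_mu_monad S.
Proof.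
split=> [l m n g h|n]; apply: (can_inj (@EK _ _)); rewrite GK !Emap_cls.
  exact/esym/Egen_gcomp.
have renE : ren C id = idm n by apply: tupE => i; rewrite cmpf1.
have Ar : << ren C id >> \in eig k Z n n by rewrite renE; apply: eig_id.
rewrite (Egen_gunit _ Ar); apply: cls_congr.
by rewrite renE.
Qed.

Lemma pull_is_Cat : is_Cat S.
Proof.
split; first exact: pull_is_mu_monad.
  by move=> m n m' n' g h; apply: (can_inj (@EK _ _)); rewrite GK !Emap_cls; apply/esym/Egen_gtens.
move=> m n; apply: (can_inj (@EK _ _)); rewrite GK Emap_cls.
have renE : ren C (@blockswap m n) = swapm C m n.
  by apply: eq_tup => i; rewrite /blockswap; case: (split i) => j; rewrite ?proj_prl ?proj_prr.
have Ar : << ren C (@blockswap m n) >> \in eig k Z _ _ by rewrite renE; apply: eig_swap.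
rewrite (Egen_gunit _ Ar); apply: cls_congr.
by rewrite renE.
Qed.

Lemma pull_natural m (nu : 'I_m -> nat) (x : forall i, Phi 1 (nu i)) (s : 'S_(\sum_(i < m) nu i)) :
  E (mu_tensor (O := OC) x s) = mcomp P (ptensn P x) (pperm P s).
Proof.
have [f [Af ->]] := phi_rep x.
rewrite Emap_tensor pperm_Phi; apply/esym; rewrite /ptensn [X in mcomp _ X _]phi_tensn_cls.
exact: phi_compE.
Qed.
End Main.

Definition operad_with (k : fieldType) (C : lawvere) (Z : zero_object C)
    (act : forall n, Phi k Z 1 n -> 'S_n -> Phi k Z 1 n) : operad_data k :=
  {| ocar := Phi k Z 1; oact := act; ounit := ounit (OC k Z); ocomp := @ocomp _ (OC k Z) |}.

(** [operad_of (Phi_prop k Z)] and [OC k Z] share all components by conversion except the action,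
    where equality is only provable. Abstracting the action lets that equation be substituted in all
    the types that depend on it. *)
Lemma operadic_act (k : fieldType) (C : lawvere) (Z : zero_object C) act :
  act = @oact _ (OC k Z) ->
  exists2 S : prop_on (mu (@operad_with k C Z act)), is_Cat S &
  exists2 F : forall m n, {linear mu (@operad_with k C Z act) m n -> Phi k Z m n},
    (forall m (nu : 'I_m -> nat) (x : forall i, Phi k Z 1 (nu i)) (s : 'S_(\sum_(i < m) nu i)),
      F m _ (mu_tensor (O := operad_with act) x s)
      = mcomp (Phi_prop k Z) (ptensn (Phi_prop k Z) x) (pperm (Phi_prop k Z) s)) &
    prop_iso S (Phi_prop k Z) F.
Proof.
move=> ->; have [G [EK GK]] := Emap_bijective k Z.
exists (pull_prop (@Emap_lin k C Z) EK GK (Phi_prop k Z)); first exact: pull_is_Cat.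
exists (Fmap (@Emap_lin k C Z)); last exact: pull_prop_iso.
exact: pull_natural.
Qed.

Theorem corollary9p10 (k : fieldType) (C : lawvere) (Z : zero_object C) :
  (exists2 M : monad_on (mu (OC k Z)), is_mu_monad M &
   exists2 E : forall m n : nat, {linear mu (OC k Z) m n -> Phi k Z m n},
     is_EC E & monad_iso M (Phi_monad k Z) E)
  /\ operadic (Phi_prop k Z).
Proof.
split; last first.
  apply: operadic_act; apply: functional_extensionality_dep => n.
  apply: functional_extensionality_dep => x; apply: functional_extensionality_dep => s.
  by rewrite pperm_Phi.
have [G [EK GK]] := Emap_bijective k Z.
exists (pull_monad (@Emap_lin k C Z) EK GK (Phi_monad k Z)).
  exact: (pull_is_mu_monad EK GK).
exists (Fmap (@Emap_lin k C Z)); last exact: pull_monad_iso.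
by move=> m nu f Af s; apply: Emap_tensor.
Qed.
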